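(* Let $(\Omega,\mu)$ be a measure space, let $1<p<\infty$, let $p'=\frac{p}{p-1}$, and let $T\colon L^p(\Omega)\to L^p(\Omega)$ be a power bounded operator (i.e. $\sup_{n\geq 0}\|T^n\|<\infty$). Assume that there is a constant $C>0$ such that $\|x\|_{T,1}\leq C\|x\|_{L^p}$ for all $x\in L^p(\Omega)$ and $\|y\|_{T^*,1}\leq C\|y\|_{L^{p'}}$ for all $y\in L^{p'}(\Omega)$. Then $T$ is $R$-Ritt.
   Context: Let $(\varepsilon_k)_{k\geq 1}$ be a sequence of independent Rademacher variables on a probability space $(\mathcal{M},d\mathbb{P})$. For a Banach space $X$, $\mathrm{Rad}(X)$ is the closed span of $\{\varepsilon_k\otimes x : k\geq 1,x\in X\}$ in $L^2(\mathcal{M};X)$, with the $L^2(\mathcal{M};X)$-norm. For a bounded operator $S\colon X\to X$ and $x\in X$, set $$\|x\|_{S,1}=\Bigl\|\sum_{k=1}^\infty k^{1/2}\,\varepsilon_k\otimes S^{k-1}(I-S)(x)\Bigr\|_{\mathrm{Rad}(X)}$$ if the series converges in $L^2(\mathcal{M};X)$, and $\|x\|_{S,1}=\infty$ otherwise. (When $X=L^q(\Omega)$, $1\le q<\infty$, this is equivalent to $\bigl\|\bigl(\sum_{k\ge1} k|S^{k-1}(I-S)x|^2\bigr)^{1/2}\bigr\|_{L^q(\Omega)}$.) A set $E\subset B(X)$ is $R$-bounded if there is $C\geq 0$ such that $\|\sum_k\varepsilon_k\otimes T_k(x_k)\|_{\mathrm{Rad}(X)}\leq C\|\sum_k\varepsilon_k\otimes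 x_k\|_{\mathrm{Rad}(X)}$ for all finite families $(T_k)_k$ in $E$ and $(x_k)_k$ in $X$. An operator $T\in B(X)$ is $R$-Ritt if the two sets $\{T^n : n\geq 0\}$ and $\{n(T^n-T^{n-1}) : n\geq 1\}$ are $R$-bounded. *)

(* Defs.v *)
From HB Require Import structures.
From mathcomp Require Import all_boot all_order all_algebra.
From mathcomp Require Import complex.
From mathcomp Require Import all_classical all_reals all_analysis.
From mathcomp Require Import measurable_realfun.

Set Implicit Arguments.
Unset Strict Implicit.
Unset Printing Implicit Defensive.

Import Order.TTheory GRing.Theory Num.Theory.
Import numFieldNormedType.Exports.

Local Open Scope classical_set_scope.
Local Open Scope ring_scope.
Local Open Scope complex_scope.
Local Open Scope quotient_scope.

(* In MathComp the norm of a complex normed space takes its values in R[i];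
   rnorm is the same norm, seen as a real number. *)
Definition rnorm (R : realType) (V : normedZmodType R[i]) (x : V) : R :=
  complex.Re `|x|.

Section rnorm_theory.
Variables (R : realType).

Section zmod.
Variable (V : normedZmodType R[i]).
Implicit Types x y : V.

Lemma rnormE x : (rnorm x)%:C = `|x|.
Proof. by rewrite /rnorm RRe_real// normr_real. Qed.

Lemma rnorm_ge0 x : 0 <= rnorm x.
Proof. by rewrite -lecR rnormE normr_ge0. Qed.

Lemma ler_rnormD x y : rnorm (x + y) <= rnorm x + rnorm y.
Proof. by rewrite -lecR rmorphD/= !rnormE ler_normD. Qed.

Lemma rnormN x : rnorm (- x) = rnorm x.
Proof. by rewrite /rnorm normrN. Qed.

Lemma rnorm_eq0 x : (rnorm x == 0) = (x == 0).
Proof. by rewrite -(inj_eq (@complexI R)) rnormE normr_eq0. Qed.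
End zmod.

Lemma rnormM (a b : R[i]) : rnorm (a * b) = rnorm a * rnorm b.
Proof. by apply: complexI; rewrite rmorphM/= !rnormE normrM. Qed.

Lemma rnorm_complexE (a : R[i]) :
  rnorm a = Num.sqrt (complex.Re a ^+ 2 + complex.Im a ^+ 2).
Proof. by rewrite /rnorm normc_def. Qed.
End rnorm_theory.

Section complex_Lfun.
Context d (Om : measurableType d) (R : realType).
Variable mu : {measure set Om -> \bar R}.

(* Borel measurability for C = R^2 *)
Definition cmeasurable_fun (f : Om -> R[i]) :=
  measurable_fun [set: Om] (fun w => complex.Re (f w)) /\
  measurable_fun [set: Om] (fun w => complex.Im (f w)).

Lemma cmeasurable_rnorm f : cmeasurable_fun f ->
  measurable_fun [set: Om] (fun w => rnorm (f w)).
Proof.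
move=> [mRe mIm]; under eq_fun do rewrite rnorm_complexE.
apply: (@measurableT_comp _ _ _ _ _ _ (@Num.sqrt R)).
  by apply: continuous_measurable_fun; exact: sqrt_continuous.
by apply: measurable_funD; exact: measurable_funX.
Qed.

Lemma cmeasurable_fun0 : cmeasurable_fun 0.
Proof. by split; exact: measurable_cst. Qed.

Lemma cmeasurable_funD f g :
  cmeasurable_fun f -> cmeasurable_fun g -> cmeasurable_fun (f + g).
Proof.
move=> [fR fI] [gR gI]; split.
  rewrite [X in measurable_fun _ X](_ : _ =
    (fun w => complex.Re (f w)) \+ (fun w => complex.Re (g w))).
    exact: measurable_funD.
  by apply/funext => w /=; rewrite fctE /=; case: (f w) (g w) => [? ?] [].
rewrite [X in measurable_fun _ X](_ : _ =
  (fun w => complex.Im (f w)) \+ (fun w => complex.Im (g w))).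
  exact: measurable_funD.
by apply/funext => w /=; rewrite fctE /=; case: (f w) (g w) => [? ?] [].
Qed.

Lemma cmeasurable_funZ a f : cmeasurable_fun f -> cmeasurable_fun (a *: f).
Proof.
move=> [fR fI]; split.
  rewrite [X in measurable_fun _ X](_ : _ =
    (fun w => complex.Re a * complex.Re (f w)) \-
    (fun w => complex.Im a * complex.Im (f w))).
    by apply: measurable_funB; exact: measurable_funM.
  by apply/funext => w /=; rewrite fctE /=; case: (f w) a => [? ?] [].
rewrite [X in measurable_fun _ X](_ : _ =
  (fun w => complex.Re a * complex.Im (f w)) \+
  (fun w => complex.Im a * complex.Re (f w))).
  by apply: measurable_funD; exact: measurable_funM.
by apply/funext => w /=; rewrite fctE /=; case: (f w) a => [? ?] [].
Qed.

Definition cLnorm (p : R) (f : Om -> R[i]) : \bar R :=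
  Lnorm mu p%:E (fun w => (rnorm (f w))%:E).

Lemma cLnorm_ge0 p f : (0 <= cLnorm p f)%E.
Proof. exact: Lnorm_ge0. Qed.

Lemma cLnorm0 (p : R) : 1 <= p -> cLnorm p 0 = 0%E.
Proof.
move=> p1; rewrite /cLnorm [X in Lnorm _ _ X](_ : _ = cst 0%E).
  by rewrite Lnorm0// gt_eqF// lte_fin (lt_le_trans ltr01).
by apply/funext => w /=; congr EFin; apply/eqP; rewrite rnorm_eq0.
Qed.

Lemma measurable_poweR_norm (p : R) (g : Om -> R) :
  measurable_fun [set: Om] g ->
  measurable_fun [set: Om] (fun w => `|(g w)%:E| `^ p)%E.
Proof.
move=> mg.
apply: (@measurableT_comp _ _ _ _ _ _ (fun x : \bar R => x `^ p)%E) => /=.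
  exact: measurable_poweR.
by do 2 apply: measurableT_comp => //.
Qed.

Lemma le_cLnorm (p : R) (f : Om -> R[i]) (g : Om -> R) : 1 <= p ->
  cmeasurable_fun f -> measurable_fun [set: Om] g ->
  (forall w, rnorm (f w) <= g w) ->
  (cLnorm p f <= Lnorm mu p%:E (EFin \o g))%E.
Proof.
move=> p1 mf mg fg; rewrite /cLnorm unlock.
have p0 : 0 <= p by rewrite (le_trans ler01).
have I0 (h : Om -> R) : (0 <= \int[mu]_w (`|(h w)%:E| `^ p))%E.
  by apply: integral_ge0 => w _; exact: poweR_ge0.
apply: gt0_ler_poweR; rewrite ?invr_ge0 ?in_itv/= ?andbT ?leey ?I0//.
apply: ge0_le_integral => [//|w _|||w _].
- by rewrite lee_fin powR_ge0.
- exact/measurable_poweR_norm/cmeasurable_rnorm.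
- exact: measurable_poweR_norm.
rewrite /= lee_fin ge0_ler_powR// ?nnegrE//.
by rewrite ger0_norm ?rnorm_ge0// (le_trans (fg w))// ler_norm.
Qed.

Lemma cLnormD (p : R) f g : 1 <= p -> cmeasurable_fun f -> cmeasurable_fun g ->
  (cLnorm p (f + g)%R <= cLnorm p f + cLnorm p g)%E.
Proof.
move=> p1 mf mg; have mf' := cmeasurable_rnorm mf.
have mg' := cmeasurable_rnorm mg.
pose h w := rnorm (f w) + rnorm (g w).
apply: (@le_trans _ _ (Lnorm mu p%:E (EFin \o h))); last first.
  exact: minkowski_EFin.
apply: le_cLnorm => //; first exact: cmeasurable_funD.
  exact: measurable_funD.
by move=> w; exact: ler_rnormD.
Qed.

Lemma cLnormZ (p : R) a f : 1 <= p -> cmeasurable_fun f ->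
  (cLnorm p (a *: f)%R = (rnorm a)%:E * cLnorm p f)%E.
Proof.
move=> p1 mf; rewrite /cLnorm unlock.
have p0 : 0 < p by rewrite (lt_le_trans ltr01).
under eq_integral => w _.
  rewrite fctE rnormM EFinM abseM poweRM ?abse_ge0//.
  rewrite gee0_abs ?lee_fin ?rnorm_ge0//.
  over.
have I0 : (0 <= \int[mu]_w (`|(rnorm (f w))%:E| `^ p))%E.
  by apply: integral_ge0 => w _; exact: poweR_ge0.
rewrite ge0_integralZl; first last.
- by rewrite poweR_ge0.
- by move=> w _; exact: poweR_ge0.
- exact/measurable_poweR_norm/cmeasurable_rnorm.
- by [].
rewrite poweRM ?poweR_ge0//.
by rewrite -poweRrM mulfV ?gt_eqF// poweRe1// lee_fin rnorm_ge0.
Qed.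

Section fixed_exponent.
Variables (p : R) (p1 : 1 <= p).

(* The hypothesis 1 <= p, although not used in the definition, is a parameter
   so that the vector space structure can be inferred. *)
Definition cLfun_pred of 1 <= p : {pred Om -> R[i]} :=
  mem [set f | cmeasurable_fun f /\ (cLnorm p f < +oo)%E].

Lemma cLfun_submod_closed : submod_closed (cLfun_pred p1).
Proof.
split; first by rewrite inE /=; split;
  [exact: cmeasurable_fun0 | rewrite cLnorm0].
move=> a f g; rewrite !inE /= => -[mf ff] [mg fg].
have maf := cmeasurable_funZ a mf; split; first exact: cmeasurable_funD.
apply: (le_lt_trans (cLnormD p1 maf mg)).
rewrite lte_add_pinfty// cLnormZ// lte_mul_pinfty ?lee_fin//.
exact: rnorm_ge0.
Qed.

HB.instance Definition _ := GRing.isSubmodClosed.Build R[i] (Om -> R[i])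
  (cLfun_pred p1) cLfun_submod_closed.

Definition cLfun : Type := {f : Om -> R[i] | f \in cLfun_pred p1}.
HB.instance Definition _ := [isSub of cLfun for @sval _ _].
HB.instance Definition _ := [Choice of cLfun by <:].
HB.instance Definition _ := [SubChoice_isSubLmodule of cLfun by <:].

Lemma cLfun_measurable (f : cLfun) : cmeasurable_fun (val f).
Proof. by have := valP f; rewrite inE => -[]. Qed.

Lemma cLfun_lty (f : cLfun) : (cLnorm p (val f) < +oo)%E.
Proof. by have := valP f; rewrite inE => -[]. Qed.

Definition cnull : {pred cLfun} :=
  mem [set f : cLfun | {ae mu, forall w, val f w = 0}].

Lemma cnull_submod_closed : submod_closed cnull.
Proof.
split; first by rewrite inE /=; apply: nearW.
move=> a f g; rewrite !inE /= => f0 g0.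
by apply: filterS2 f0 g0 => w /= fw gw; rewrite !fctE fw gw scaler0 addr0.
Qed.

HB.instance Definition _ := GRing.isSubmodClosed.Build R[i] cLfun
  cnull cnull_submod_closed.

(* L^p(Omega; C) modulo almost everywhere equality; its norm is set up below. *)
Definition Lp : Type := Quotient.quot cnull.
HB.instance Definition _ := GRing.Zmodule.on Lp.
HB.instance Definition _ := EqQuotient.on Lp.


Lemma cnullE (f : cLfun) : (f \in cnull) = `[< {ae mu, forall w, val f w = 0} >].
Proof. by []. Qed.

Lemma eqLpP (f g : cLfun) :
  \pi_Lp f = \pi_Lp g <-> {ae mu, forall w, val f w = val g w}.
Proof.
split.
  move/eqP; rewrite -Quotient.idealrBE cnullE => /asboolP.
  by apply: filterS => w /= /eqP; rewrite subr_eq0 => /eqP.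
move=> fg; apply/eqP; rewrite -Quotient.idealrBE cnullE; apply/asboolP.
by apply: filterS fg => w /= fgw; apply/eqP; rewrite subr_eq0 fgw.
Qed.

Definition Lp_scale (a : R[i]) (u : Lp) : Lp := \pi_Lp (a *: repr u).

Lemma Lp_scale_pi a f : Lp_scale a (\pi_Lp f) = \pi_Lp (a *: f).
Proof.
apply/eqLpP; have /eqLpP : \pi_Lp (repr (\pi_Lp f)) = \pi_Lp f by rewrite reprK.
by apply: filterS => w /= fw; congr (_ *: _).
Qed.

Lemma Lp_scaleA a b u : Lp_scale a (Lp_scale b u) = Lp_scale (a * b) u.
Proof. by elim/quotW: u => f; rewrite (Lp_scale_pi b) !Lp_scale_pi scalerA. Qed.

Lemma Lp_scale1 : left_id 1 Lp_scale.
Proof. by elim/quotW => f; rewrite Lp_scale_pi scale1r. Qed.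

Lemma Lp_scaleDr : right_distributive Lp_scale +%R.
Proof.
move=> a; elim/quotW => f; elim/quotW => g.
rewrite !Lp_scale_pi -!(raddfD \pi_Lp).
by rewrite Lp_scale_pi scalerDr.
Qed.

Lemma Lp_scaleDl u : {morph Lp_scale^~ u : a b / a + b}.
Proof.
by move=> a b; elim/quotW: u => f; rewrite !Lp_scale_pi -(raddfD \pi_Lp) scalerDl.
Qed.

HB.instance Definition _ := GRing.Zmodule_isLmodule.Build R[i] Lp
  Lp_scaleA Lp_scale1 Lp_scaleDr Lp_scaleDl.

Definition Lp_norm (u : Lp) : R[i] := (fine (cLnorm p (val (repr u))))%:C.

Lemma cLnorm_ae (f g : cLfun) : {ae mu, forall w, val f w = val g w} ->
  cLnorm p (val f) = cLnorm p (val g).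
Proof.
move=> fg; rewrite /cLnorm unlock; congr poweR.
apply: ae_eq_integral => //.
- exact/measurable_poweR_norm/cmeasurable_rnorm/cLfun_measurable.
- exact/measurable_poweR_norm/cmeasurable_rnorm/cLfun_measurable.
by apply: filterS fg => w /= -> _.
Qed.

Lemma Lp_norm_pi f : Lp_norm (\pi_Lp f) = (fine (cLnorm p (val f)))%:C.
Proof.
congr (fine _)%:C; apply: cLnorm_ae.
by apply/eqLpP; rewrite reprK.
Qed.

Lemma cLfun_fin_num (f : cLfun) : cLnorm p (val f) \is a fin_num.
Proof. by rewrite ge0_fin_numE ?cLnorm_ge0// cLfun_lty. Qed.

Lemma Lp_ler_normD u v : Lp_norm (u + v) <= Lp_norm u + Lp_norm v.
Proof.
elim/quotW: u => f; elim/quotW: v => g.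
rewrite -(raddfD \pi_Lp) !Lp_norm_pi -rmorphD/= lecR.
rewrite -lee_fin EFinD !fineK ?cLfun_fin_num//.
  exact: cLnormD (cLfun_measurable f) (cLfun_measurable g).
exact: cLfun_fin_num (f + g).
Qed.

Lemma Lp_normrZ a u : Lp_norm (a *: u) = `|a| * Lp_norm u.
Proof.
elim/quotW: u => f.
rewrite [_ *: _]Lp_scale_pi !Lp_norm_pi -rnormE -rmorphM/=.
congr (_%:C); apply: EFin_inj; rewrite EFinM !fineK ?cLfun_fin_num//.
  exact: cLnormZ (cLfun_measurable f).
exact: cLfun_fin_num (a *: f).
Qed.

Lemma Lp_normr0_eq0 u : Lp_norm u = 0 -> u = 0.
Proof.
elim/quotW: u => f; rewrite Lp_norm_pi => /complexI f0.
rewrite -(raddf0 \pi_Lp); apply/eqLpP.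
have mf : measurable_fun [set: Om] (fun w => (rnorm (val f w))%:E).
  exact/measurable_EFinP/cmeasurable_rnorm/(cLfun_measurable f).
have Nf0 : cLnorm p (val f) = 0%E.
  by rewrite -[LHS]fineK ?f0//; exact: (cLfun_fin_num f).
have p0 : (0 < p%:E :> \bar R)%E by rewrite lte_fin (lt_le_trans ltr01).
apply: filterS (Lnorm_eq0_eq0 mf p0 Nf0) => w /= /(_ I) [] /eqP.
by rewrite rnorm_eq0 => /eqP.
Qed.

HB.instance Definition _ := Lmodule_isNormed.Build R[i] Lp
  Lp_ler_normD Lp_normrZ Lp_normr0_eq0.

Lemma rnorm_LpE (u : Lp) : (rnorm u)%:E = cLnorm p (val (repr u)).
Proof. by rewrite -[RHS]fineK ?cLfun_fin_num. Qed.

End fixed_exponent.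
End complex_Lfun.

Definition cRintegral d (Om : measurableType d) (R : realType)
    (mu : {measure set Om -> \bar R}) (f : Om -> R[i]) : R[i] :=
  (\int[mu]_w complex.Re (f w)) +i* (\int[mu]_w complex.Im (f w)).

Definition conj_exp (R : realType) (p : R) : R := p / (p - 1).

Lemma conj_exp_ge1 (R : realType) (p : R) : 1 < p -> 1 <= conj_exp p.
Proof.
by move=> p1; rewrite /conj_exp ler_pdivlMr ?subr_gt0// mul1r gerBl ler01.
Qed.

Section duality.
Context d (Om : measurableType d) (R : realType).
Variables (mu : {measure set Om -> \bar R}) (p q : R).
Variables (p1 : 1 <= p) (q1 : 1 <= q).

Definition Lp_pairing (u : Lp mu p1) (v : Lp mu q1) : R[i] :=
  cRintegral mu (fun w => val (repr u) w * val (repr v) w).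

(* For q the conjugate exponent of p and S bounded, there is exactly one such
   S', namely the Banach space adjoint of S when the dual of L^p is identified
   with L^q. *)
Definition Lp_adjoint (S : Lp mu p1 -> Lp mu p1) (S' : Lp mu q1 -> Lp mu q1) :=
  forall u v, Lp_pairing (S u) v = Lp_pairing u (S' v).
End duality.

Section rademacher.
Context dM (M : measurableType dM) (R : realType) (P : probability M R).

Definition mutually_independent (eps : nat -> {RV P >-> R}) :=
  forall (s : seq nat) (A : nat -> set R), uniq s ->
    (forall k, measurable (A k)) ->
    P (\bigcap_(k in [set` s]) (eps k @^-1` A k)) =
    (\prod_(k <- s) P (eps k @^-1` A k))%E.

Definition rademacher_seq (eps : nat -> {RV P >-> R}) :=
  mutually_independent eps /\
  forall k, P (eps k @^-1` [set 1]) = (2^-1)%:E /\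
            P (eps k @^-1` [set -1]) = (2^-1)%:E.
End rademacher.

Section Rad.
Context dM (M : measurableType dM) (R : realType) (P : probability M R).
Variables (eps : nat -> {RV P >-> R}) (X : normedModType R[i]).
Implicit Types (F : M -> X) (S T : X -> X) (x : X).

Definition vsimple_fun F :=
  finite_set (range F) /\ forall x, measurable (F @^-1` [set x]).

Definition strongly_measurable F :=
  exists s : nat -> M -> X,
    (forall n, vsimple_fun (s n)) /\ forall m, s ^~ m @ \oo --> F m.

Definition L2norm F : \bar R := Lnorm P 2%:E (fun m => (rnorm (F m))%:E).

Definition L2fun : set (M -> X) :=
  [set F | strongly_measurable F /\ (L2norm F < +oo)%E].

Definition L2_cvg (u : nat -> M -> X) F :=
  L2fun F /\ (fun n => L2norm (u n \- F)) @ \oo --> 0%E.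

(* eps is indexed from 0: eps k is the (k+1)-st Rademacher variable. *)
Definition Rad_sum n (x : 'I_n -> X) : M -> X :=
  fun m => \sum_(k < n) (eps k m)%:C *: x k.

(* The index k stands for k + 1 in the series
   \sum_(k >= 1) k^(1/2) eps_k (x) S^(k-1) (I - S) x. *)
Definition square_partial_sum S x n : M -> X :=
  Rad_sum (fun k : 'I_n => (Num.sqrt k.+1%:R)%:C *: iter k S (x - S x)).

(* The value does not depend on the chosen limit F, which is unique up to
   P-almost everywhere equality. *)
Definition square_norm S x : \bar R :=
  if pselect (exists F, L2_cvg (square_partial_sum S x) F) is left h
  then L2norm (projT1 (cid h)) else +oo%E.

Definition R_bounded (E : set (X -> X)) :=
  exists2 C : R, 0 <= C &
    forall n (T : 'I_n -> X -> X) (x : 'I_n -> X), (forall k, E (T k)) ->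
      (L2norm (Rad_sum (fun k => T k (x k))) <= C%:E * L2norm (Rad_sum x))%E.

Definition R_Ritt T :=
  R_bounded [set iter n T | n in [set: nat]] /\
  R_bounded [set (fun x => n%:R *: (iter n T x - iter n.-1 T x))
            | n in [set n | (1 <= n)%N]].
End Rad.

Section power_bounded.
Context (R : realType) (X : normedModType R[i]).

Definition op_norm (S : X -> X) : \bar R :=
  ereal_sup [set (rnorm (S x))%:E | x in [set x | rnorm x <= 1]].

Definition power_bounded (T : X -> X) : Prop :=
  (ereal_sup [set op_norm (iter n T) | n in [set: nat]] < +oo)%E.
End power_bounded.

(* Main.v *)
(* The square function estimates are used through the family
     V_(j,m) = sum_(k < m) (k+1) T^(j+k) (I - T)^2
             = T^j - T^(j+m) - m T^(j+m) (I - T).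
   Writing k = k/2 + uphalf k and moving half of the factors to T^*,
     <V_(j,m) x, y> = sum_k (k+1) <T^(j+k/2) (I-T) x, T^*^(uphalf k) (I-T^* ) y>,
   so by Cauchy-Schwarz, Hoelder and a lower Khintchine inequality (applied once
   to the square function series, and once, in its Hilbert-valued form, to a
   random sum of the x's) the two hypotheses bound sum_n <V_n x_n, y_n> by the
   product of the Rademacher norms of (x_n) and (y_n).  With
   y_n = conj(z_n) G^(p-2), where z_n = V_n x_n and G = (sum_n |z_n|^2)^(1/2), the
   left-hand side is the p-th power of the L^p norm of G, and an upper Khintchine
   inequality in L^p and in L^p' turns this into R-boundedness of all V_(j,m).
   The rest is algebra: m T^m (I-T) = I - T^m - V_(0,m) is uniformly bounded, and
     T^n = T^N + ((N-n)/N) N T^N (I-T) + V_(n,N-n)   for n <= N,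
     n (T^n - T^(n-1)) = - I + V_(0,n-1) + T^n.
   For a finite family N is fixed, so each of the first two terms of T^n is a
   scalar in [0,1] times a single operator, of norm bounded independently of N.
   All Rademacher sums are replaced by finite averages over signs. *)

Require Import Defs.
From mathcomp Require Import all_boot all_order all_algebra.
From mathcomp Require Import complex.
From mathcomp Require Import all_classical all_reals all_analysis.
From mathcomp Require Import measurable_realfun ring lra zify.

Set Implicit Arguments.
Unset Strict Implicit.
Unset Printing Implicit Defensive.

Import Order.TTheory GRing.Theory Num.Theory.
Import numFieldNormedType.Exports HBSimple.

Local Open Scope classical_set_scope.
Local Open Scope ring_scope.
Local Open Scope complex_scope.
Local Open Scope quotient_scope.

(** * Averages over signs *)

(** The expectation of f (u + e_1 x_1 + ... + e_n x_n) over independent uniform signs e_i. The base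
    point u absorbs one sign at a time in inductions on the list. *)
Fixpoint sign_avg (R : realType) (V : zmodType) (f : V -> R) (u : V)
    (l : seq V) : R :=
  if l is x :: l' then (sign_avg f (u + x) l' + sign_avg f (u - x) l') / 2
  else f u.

Section sign_avg_theory.
Context (R : realType).

(** Chosen representatives of [Lp] classes are additive only up to null sets, so some sign sums have
    to be compared through a relation stable under sums and differences rather than through a
    map. *)
Lemma sign_avg_le_rel (V W : zmodType) (rel : V -> W -> Prop)
    (f : V -> R) (g : W -> R) :
  (forall v w v' w', rel v w -> rel v' w' -> rel (v + v') (w + w')) ->
  (forall v w v' w', rel v w -> rel v' w' -> rel (v - v') (w - w')) ->
  (forall v w, rel v w -> f v <= g w) ->
  forall (l : seq (V * W)) u u', rel u u' ->
  (forall vw, vw \in l -> rel vw.1 vw.2) ->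
  sign_avg f u (map fst l) <= sign_avg g u' (map snd l).
Proof.
move=> relD relB fg; elim=> [|[v w] l IH] u u' uu' ll /=; first exact: fg.
have vw : rel v w by apply: (ll (v, w)); rewrite inE eqxx.
have ll' : forall vw, vw \in l -> rel vw.1 vw.2.
  by move=> vw' vw'l; apply: ll; rewrite inE vw'l orbT.
by rewrite ler_pM2r ?invr_gt0// lerD// IH//; [exact: relD | exact: relB].
Qed.

Variable V : zmodType.
Implicit Types (f g : V -> R) (u : V) (l : seq V).

Lemma le_sign_avg f g u l :
  (forall v, f v <= g v) -> sign_avg f u l <= sign_avg g u l.
Proof.
move=> fg; elim: l u => [|x l IH] u //=.
by rewrite ler_pM2r ?invr_gt0// lerD.
Qed.

Lemma sign_avgD f g u l :
  sign_avg (fun v => f v + g v) u l = sign_avg f u l + sign_avg g u l.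
Proof. by elim: l u => [|x l IH] u //=; rewrite !IH; field. Qed.

Lemma sign_avgZ (c : R) f u l :
  sign_avg (fun v => c * f v) u l = c * sign_avg f u l.
Proof. by elim: l u => [|x l IH] u //=; rewrite !IH; field. Qed.

Lemma sign_avg_cst (c : R) u l : sign_avg (fun=> c) u l = c.
Proof. by elim: l u => [|x l IH] u //=; rewrite !IH; field. Qed.

Lemma sign_avg_ge0 f u l : (forall v, 0 <= f v) -> 0 <= sign_avg f u l.
Proof.
move=> f0; elim: l u => [|x l IH] u //=.
by rewrite mulr_ge0 ?invr_ge0// addr_ge0.
Qed.

Lemma sqr_sign_avg_le f u l :
  sign_avg f u l ^+ 2 <= sign_avg (fun v => f v ^+ 2) u l.
Proof.
elim: l u => [|x l IH] u //=.
have := IH (u + x); have := IH (u - x).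
set a := sign_avg f _ l; set b := sign_avg f _ l => h1 h2.
have := sqr_ge0 (a - b); lra.
Qed.

Lemma sign_avg_le_sqrt f u l : (forall v, 0 <= f v) ->
  sign_avg f u l <= Num.sqrt (sign_avg (fun v => f v ^+ 2) u l).
Proof.
move=> f0; rewrite -[leLHS]ger0_norm ?sign_avg_ge0// -sqrtr_sqr.
by rewrite ler_wsqrtr// sqr_sign_avg_le.
Qed.
End sign_avg_theory.

Lemma sign_avg_map (R : realType) (V W : zmodType) (h : V -> W) (f : W -> R)
    u (l : seq V) : {morph h : x y / x + y} -> {morph h : x y / x - y} ->
  sign_avg f (h u) (map h l) = sign_avg (f \o h) u l.
Proof.
move=> hD hB; elim: l u => [|x l IH] u //=.
by rewrite -hD -hB !IH.
Qed.

(** * Khintchine inequalities in an abstract Hilbert space *)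

Section hilbert_moments.
Context (R : realType) (V : zmodType).
Variables (nsq : V -> R) (ip : V -> V -> R).
Hypothesis nsq_ge0 : forall x, 0 <= nsq x.
Hypothesis nsq0 : nsq 0 = 0.
Hypothesis nsqD : forall x y, nsq (x + y) = nsq x + nsq y + 2 * ip x y.
Hypothesis nsqB : forall x y, nsq (x - y) = nsq x + nsq y - 2 * ip x y.
Hypothesis ip_CS : forall x y, ip x y ^+ 2 <= nsq x * nsq y.
Implicit Types (u : V) (l : seq V).

(** The two signs in front of x cancel the cross term, so squared norms add up exactly. *)
Lemma sign_avg_nsq u l : sign_avg nsq u l = nsq u + \sum_(x <- l) nsq x.
Proof.
elim: l u => [|x l IH] u /=; first by rewrite big_nil addr0.
by rewrite !IH big_cons nsqD nsqB; field.
Qed.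

(** The even and odd parts p and q in B of (A + B)^m are bounded together: they evolve by p' = A p +
    B q and q' = A q + B p, and B^2 <= A d bounds the term B^2 p occurring in B q'. The separate n
    keeps the base Q fixed while m grows. *)
Lemma even_binomial_le (A B d : R) m n : (m <= n)%N ->
  0 <= A -> 0 <= d -> B ^+ 2 <= A * d ->
  ((A + B) ^+ m + (A - B) ^+ m) / 2 <= (A + n%:R * d) ^+ m.
Proof.
move=> + A0 d0 BAd; set Q := A + n%:R * d.
have AQ : A <= Q by rewrite lerDl mulr_ge0.
have Q0 : 0 <= Q by exact: le_trans AQ.
suff : (m <= n)%N -> ((A + B) ^+ m + (A - B) ^+ m) / 2 <= Q ^+ m /\
   B * (((A + B) ^+ m - (A - B) ^+ m) / 2) <= m%:R * d * Q ^+ m.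
  by move=> H /H[].
elim: m => [_|m IH mn]; first by rewrite !expr0; split; lra.
have [] := IH (ltnW mn).
set p := _ / 2; set q := _ / 2 => hp hq.
have -> : ((A + B) ^+ m.+1 + (A - B) ^+ m.+1) / 2 = A * p + B * q.
  by rewrite /p /q !exprS; field.
have -> : ((A + B) ^+ m.+1 - (A - B) ^+ m.+1) / 2 = A * q + B * p.
  by rewrite /p /q !exprS; field.
have Qm0 : 0 <= Q ^+ m by rewrite exprn_ge0.
split.
  rewrite exprS; apply: (@le_trans _ _ (A * Q ^+ m + m%:R * d * Q ^+ m)).
    by rewrite lerD// ler_wpM2l.
  rewrite -mulrDl ler_wpM2r// lerD2l ler_wpM2r// ler_nat; lia.
rewrite mulrDr mulrCA [B * (B * p)]mulrA -expr2.
apply: (@le_trans _ _ (A * (m%:R * d * Q ^+ m) + A * d * Q ^+ m)).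
  apply: lerD; first by rewrite ler_wpM2l.
  apply: (@le_trans _ _ (B ^+ 2 * Q ^+ m)); first by rewrite ler_wpM2l// sqr_ge0.
  by rewrite ler_wpM2r.
rewrite exprS [leLHS](_ : _ = (m.+1%:R * d * Q ^+ m) * A); last first.
  by rewrite -natr1; ring.
rewrite [leRHS](_ : _ = (m.+1%:R * d * Q ^+ m) * Q); last by ring.
by rewrite ler_wpM2l// !mulr_ge0.
Qed.

(** Induction on the list, with [even_binomial_le] for the sign of the head and d = 4 [nsq x], since
    Cauchy-Schwarz gives B^2 <= 4 [nsq u] [nsq x]. This costs 4 m times [nsq x]; the 1 in 4 m + 1 is
    the [nsq x] already present in A. *)
Lemma sign_avg_nsq_expr m u l : sign_avg (fun v => nsq v ^+ m) u l <=
  (nsq u + (4 * m + 1)%:R * \sum_(x <- l) nsq x) ^+ m.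
Proof.
elim: l u => [|x l IH] u /=; first by rewrite big_nil mulr0 addr0.
set s := \sum_(y <- l) nsq y.
have s0 : 0 <= s by exact: sumr_ge0.
pose A := nsq u + nsq x + (4 * m + 1)%:R * s.
pose B := 2 * ip u x.
apply: (@le_trans _ _ (((A + B) ^+ m + (A - B) ^+ m) / 2)).
  rewrite ler_pM2r ?invr_gt0// lerD//.
    apply: le_trans (IH _) _; rewrite -/s le_eqVlt; apply/orP; left.
    by apply/eqP; congr (_ ^+ _); rewrite nsqD /A /B; ring.
  apply: le_trans (IH _) _; rewrite -/s le_eqVlt; apply/orP; left.
  by apply/eqP; congr (_ ^+ _); rewrite nsqB /A /B; ring.
have M0 : 0 <= (4 * m + 1)%:R * s by rewrite mulr_ge0.
have nu := nsq_ge0 u; have nx := nsq_ge0 x.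
apply: le_trans (@even_binomial_le A B (4 * nsq x) m m _ _ _ _) _ => //.
- by rewrite /A; lra.
- lra.
- rewrite /B exprMn; apply: (@le_trans _ _ (4 * (nsq u * nsq x))).
    by have := ip_CS u x; lra.
  rewrite (_ : A * _ = 4 * (nsq u * nsq x) + 4 * (nsq x * (nsq x + (4 * m + 1)%:R * s))); last first.
    by rewrite /A; ring.
  by rewrite lerDl mulr_ge0// mulr_ge0// addr_ge0.
rewrite big_cons -/s le_eqVlt; apply/orP; left; apply/eqP; congr (_ ^+ _).
by rewrite /A natrD natrM; ring.
Qed.

(* 24 = 18 * 4 / 3: in the proof below, truncating at t = 18 s makes t^-2 times
   the fourth moment bound 81 s^4 equal to s^2 / 4. *)
Definition khintchine_const : R := 24.

Lemma khintchine_lower l :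
  Num.sqrt (\sum_(x <- l) nsq x) <=
  khintchine_const * sign_avg (fun v => Num.sqrt (nsq v)) 0 l.
Proof.
set s2 := \sum_(x <- l) nsq x; set s := Num.sqrt s2.
set e := sign_avg _ 0 l.
have e0 : 0 <= e by apply: sign_avg_ge0 => v; exact: sqrtr_ge0.
have s20 : 0 <= s2 by exact: sumr_ge0.
have s0 : 0 <= s by exact: sqrtr_ge0.
have ss : s ^+ 2 = s2 by rewrite sqr_sqrtr.
move: s0; rewrite le_eqVlt => /orP[/eqP<-|s0]; first by rewrite mulr_ge0.
pose t := 18 * s.
have t0 : 0 < t by rewrite mulr_gt0.
(* Split at a = t: below it a^2 <= t a, above it a^2 <= t^-2 a^4. After averaging, the second
   moment, known exactly, is bounded by the first and the fourth. *)
have key v : nsq v <= t * Num.sqrt (nsq v) + t ^- 2 * nsq v ^+ 2.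
  have n0 := sqrtr_ge0 (nsq v).
  rewrite -{1 3}[nsq v]sqr_sqrtr//; set a := Num.sqrt (nsq v) in n0 *.
  have [ta|ta] := leP a t.
    rewrite (@le_trans _ _ (t * a))//; first by rewrite expr2 ler_wpM2r.
    by rewrite lerDl mulr_ge0// ?invr_ge0 ?exprn_ge0 ?sqr_ge0// ltW.
  rewrite (@le_trans _ _ (t ^- 2 * (a ^+ 2) ^+ 2))//; last first.
    by rewrite lerDr mulr_ge0// ltW.
  rewrite mulrC ler_pdivlMr ?exprn_gt0// [leRHS]expr2.
  by rewrite ler_wpM2l ?sqr_ge0// ler_pXn2r ?nnegrE ?ltW// (le_lt_trans _ ta)// ltW.
have := le_sign_avg 0 l key.
rewrite sign_avgD !sign_avgZ sign_avg_nsq nsq0 add0r -/s2 -/e => H.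
have := sign_avg_nsq_expr 2 0 l; rewrite nsq0 add0r -/s2 => H4.
have {H H4} : s2 <= t * e + t ^- 2 * ((4 * 2 + 1)%:R * s2) ^+ 2.
  by apply: le_trans H _; rewrite lerD2l ler_wpM2l// invr_ge0 sqr_ge0.
rewrite -ss /t => H.
have sn : s != 0 by rewrite gt_eqF.
have E : (18 * s) ^- 2 * ((4 * 2 + 1)%:R * s ^+ 2) ^+ 2 = s ^+ 2 / 4 by field.
rewrite {}E in H; rewrite /khintchine_const.
rewrite -(ler_pM2r s0); nra.
Qed.

Lemma khintchine_upper m l :
  sign_avg (fun v => nsq v ^+ m) 0 l <=
  (4 * m + 1)%:R ^+ m * (\sum_(x <- l) nsq x) ^+ m.
Proof. by have := sign_avg_nsq_expr m 0 l; rewrite nsq0 add0r exprMn. Qed.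
End hilbert_moments.

(** * Contraction principle for sign averages in a normed space *)

Lemma rnorm0 (R : realType) (V : normedZmodType R[i]) : rnorm (0 : V) = 0.
Proof. by apply/eqP; rewrite rnorm_eq0. Qed.

Section rnorm_sign_avg.
Context (R : realType) (X : normedModType R[i]).
Implicit Types (u v x : X) (c : R).

Lemma rnorm_realZ c x : rnorm (c%:C *: x) = `|c| * rnorm x.
Proof.
by rewrite /rnorm normrZ normc_def/= expr0n/= addr0 sqrtr_sqr -{1}rnormE -rmorphM.
Qed.

Lemma ler_rnormB_dist x v : `|rnorm x - rnorm v| <= rnorm (x - v).
Proof.
have h1 := ler_rnormD (x - v) v; have h2 := ler_rnormD (v - x) x.
rewrite subrK in h1; rewrite subrK in h2.
have h3 : rnorm (v - x) = rnorm (x - v) by rewrite -rnormN opprB.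
by rewrite ler_norml; apply/andP; split; lra.
Qed.

(** Both u + c v and u - c v are convex combinations of u + v and u - v, with weights (1 + c) / 2
    and (1 - c) / 2 in either order; convexity of the square does the rest. *)
Lemma sqr_rnorm_convex u v c : `|c| <= 1 ->
  rnorm (u + c%:C *: v) ^+ 2 + rnorm (u - c%:C *: v) ^+ 2 <=
  rnorm (u + v) ^+ 2 + rnorm (u - v) ^+ 2.
Proof.
move=> c1; have /andP[cm cp] : -1 <= c <= 1 by rewrite -ler_norml.
pose a := (1 + c) / 2; pose b := (1 - c) / 2.
have a0 : 0 <= a by rewrite /a; lra.
have b0 : 0 <= b by rewrite /b; lra.
have comb (s t : R[i]) :
    s *: (u + v) + t *: (u - v) = (s + t) *: u + (s - t) *: v.
  by rewrite !scalerDr scalerN addrACA -scalerDl -scalerBl.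
have ab1 : a + b = 1 by rewrite /a /b; field.
have abc : a - b = c by rewrite /a /b; field.
have abC1 : a%:C + b%:C = 1 :> R[i] by rewrite -(rmorphD (real_complex R)) ab1.
have abCc : a%:C - b%:C = c%:C :> R[i] by rewrite -(rmorphB (real_complex R)) abc.
have E1 : u + c%:C *: v = a%:C *: (u + v) + b%:C *: (u - v).
  by rewrite comb abC1 abCc scale1r.
have E2 : u - c%:C *: v = b%:C *: (u + v) + a%:C *: (u - v).
  by rewrite comb (addrC b%:C) abC1 -(opprB a%:C) abCc scaleNr scale1r.
have hs := ler_rnormD (a%:C *: (u + v)) (b%:C *: (u - v)).
have ht := ler_rnormD (b%:C *: (u + v)) (a%:C *: (u - v)).
move: hs ht (rnorm_ge0 (u + c%:C *: v)) (rnorm_ge0 (u - c%:C *: v)).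
rewrite -E1 -E2 !rnorm_realZ !ger0_norm//.
have ab : b = 1 - a by rewrite /a /b; field.
rewrite {}ab in b0 *.
move: (rnorm (u + c%:C *: v)) (rnorm (u - c%:C *: v)) => s t.
move: (rnorm (u + v)) (rnorm (u - v)) => y z hs ht s0 t0.
have h1 : s ^+ 2 <= (a * y + (1 - a) * z) ^+ 2.
  by rewrite ler_pXn2r ?nnegrE// (le_trans _ hs).
have h2 : t ^+ 2 <= ((1 - a) * y + a * z) ^+ 2.
  by rewrite ler_pXn2r ?nnegrE// (le_trans _ ht).
have : 0 <= a * (1 - a) * (y - z) ^+ 2 by rewrite mulr_ge0 ?sqr_ge0// mulr_ge0.
nra.
Qed.

Let convex_fun (f : X -> R) := forall u v c, `|c| <= 1 ->
  f (u + c%:C *: v) + f (u - c%:C *: v) <= f (u + v) + f (u - v).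

(** Averaging over further signs only translates the base point u, so the convexity inequality
    survives. *)
Let convex_sign_avg (f : X -> R) l : convex_fun f ->
  convex_fun (fun u => sign_avg f u l).
Proof.
move=> cf; elim: l => [|x l IH] u v c c1 /=; first exact: cf.
have := IH (u + x) v c c1; have := IH (u - x) v c c1.
rewrite ![u + x + _]addrAC ![u - x + _]addrAC.
move: (sign_avg _ _ _) (sign_avg _ _ _) (sign_avg _ _ _) (sign_avg _ _ _).
move: (sign_avg _ _ _) (sign_avg _ _ _) (sign_avg _ _ _) (sign_avg _ _ _).
by move=> *; lra.
Qed.

(** One coefficient at a time: induction removes those of the tail, then convexity removes c from
    the two base points u + c x and u - c x. *)
Lemma sign_avg_contraction (l : seq (R * X)) u :
  (forall cx, cx \in l -> `|cx.1| <= 1) ->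
  sign_avg (fun v => rnorm v ^+ 2) u [seq cx.1%:C *: cx.2 | cx <- l] <=
  sign_avg (fun v => rnorm v ^+ 2) u [seq cx.2 | cx <- l].
Proof.
elim: l u => [//|[c x] l IH] u hl /=.
have c1 : `|c| <= 1 by apply: (hl (c, x)); rewrite inE eqxx.
have hl' : forall cx, cx \in l -> `|cx.1| <= 1.
  by move=> cx cxl; apply: hl; rewrite inE cxl orbT.
rewrite ler_pM2r ?invr_gt0//.
apply: (le_trans (lerD (IH _ hl') (IH _ hl'))).
by apply: (convex_sign_avg (f := fun v => rnorm v ^+ 2)) => // ? ? ?; exact: sqr_rnorm_convex.
Qed.

Lemma sign_avg_sqr_rnorm_cat u (l1 l2 : seq X) :
  sign_avg (fun v => rnorm v ^+ 2) u l1 <=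
  sign_avg (fun v => rnorm v ^+ 2) u (l1 ++ l2).
Proof.
elim: l1 u => [|x l1 IH] u /=; last by rewrite ler_pM2r ?invr_gt0// lerD.
elim: l2 u => [//|x l2 IH] u /=.
rewrite ler_pdivlMr//; apply: le_trans (lerD (IH _) (IH _)).
(* Coefficient 0 in the convexity inequality: 2 |u|^2 <= |u + x|^2 + |u - x|^2. *)
have := @sqr_rnorm_convex u x 0; rewrite normr0 rmorph0 scale0r subr0 addr0.
by move=> /(_ ler01); lra.
Qed.
End rnorm_sign_avg.

(** * Strong measurability of random vectors *)

Section strong_measurability.
Context dM (M : measurableType dM) (R : realType) (X : normedModType R[i]).

Lemma finite_range_preimage (T : Type) (F : M -> T) : finite_set (range F) ->
  (forall x, measurable (F @^-1` [set x])) -> forall B, measurable (F @^-1` B).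
Proof.
move=> fF mF B.
rewrite (_ : F @^-1` B = \bigcup_(t in range F `&` B) F @^-1` [set t]).
  apply: fin_bigcup_measurable => //; exact: finite_setIl.
apply/seteqP; split => [m Bm|m [t [_ Bt] /= ->]//].
by exists (F m) => //; split => //; exists m.
Qed.

Lemma vsimple_fun_comp (F : M -> X) (h : X -> X) :
  vsimple_fun F -> vsimple_fun (h \o F).
Proof.
move=> [fF mF]; split.
  by rewrite (_ : range _ = h @` range F); [exact: finite_image|rewrite image_comp].
by move=> x; rewrite comp_preimage; exact: (finite_range_preimage fF mF).
Qed.

Lemma vsimple_funD (F G : M -> X) :
  vsimple_fun F -> vsimple_fun G -> vsimple_fun (F \+ G).
Proof.
move=> [fF mF] [fG mG]; split.
  apply: (@sub_finite_set _ _ [set x + y | x in range F & y in range G]).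
    by move=> _ [m _ <-]; exists (F m); [exists m|exists (G m); [exists m|]].
  exact: finite_image2.
move=> x; rewrite (_ : _ @^-1` _ =
  \bigcup_(y in range F) (F @^-1` [set y] `&` G @^-1` [set x - y])).
  apply: fin_bigcup_measurable => // y _; exact: measurableI.
apply/seteqP; split => m /=.
  by move=> <-; exists (F m); [exists m|split => //=; rewrite addrC addKr].
by move=> [y _ [/= -> ->]]; rewrite addrC subrK.
Qed.

Lemma strongly_measurableD (F G : M -> X) : strongly_measurable F ->
  strongly_measurable G -> strongly_measurable (F \+ G).
Proof.
move=> [s [vs sF]] [t [vt tG]]; exists (fun n => s n \+ t n); split.
  by move=> n; exact: vsimple_funD.
by move=> m; apply: cvgD; [exact: sF|exact: tG].
Qed.

Lemma strongly_measurableN (F : M -> X) :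
  strongly_measurable F -> strongly_measurable (\- F).
Proof.
move=> [s [vs sF]]; exists (fun n => \- s n); split.
  by move=> n; exact: (vsimple_fun_comp (@GRing.opp X) (vs n)).
by move=> m; apply: cvgN; exact: sF.
Qed.

Lemma strongly_measurable_cst (x : X) : strongly_measurable (cst x : M -> X).
Proof.
exists (fun=> cst x); split; last by move=> m; exact: cvg_cst.
move=> n; split; first exact: finite_image_cst.
by move=> y; rewrite preimage_cst; case: ifP.
Qed.

Lemma cvg_rnormP (u : nat -> X) (l : X) :
  u @ \oo --> l <-> (fun n => rnorm (u n - l)) @ \oo --> (0 : R).
Proof.
split=> ul.
  apply/(@cvgr0Pnorm_lt R R) => e e0.
  have e0' : 0 < e%:C by rewrite ltcR.
  move/cvgrPdist_lt : ul => /(_ _ e0'); apply: filterS => n; rewrite distrC -rnormE ltcR => H.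
  by rewrite ger0_norm// rnorm_ge0.
apply/cvgrPdist_lt => e e0.
(* In [R[i]], positivity means a vanishing imaginary part and a positive real part. *)
have e0' : 0 < complex.Re e by move: e0; rewrite ltcE => /andP[].
move/(@cvgr0Pnorm_lt R R) : ul => /(_ _ e0'); apply: filterS => n; rewrite ger0_norm ?rnorm_ge0// distrC => H.
rewrite -rnormE ltcE/= H andbT.
by move: e0; rewrite ltcE => /andP[].
Qed.

(** Only the scalar factor has to be approximated: multiply simple functions converging to f by the
    fixed vector x. *)
Lemma strongly_measurable_scale (f : M -> R) (x : X) :
  measurable_fun setT f -> strongly_measurable (fun m => (f m)%:C *: x).
Proof.
move=> mf.
have mf' : measurable_fun setT (EFin \o f) by exact/measurable_EFinP.
have [g gf] := approximation_sfun measurableT mf'.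
exists (fun n m => (g n m)%:C *: x); split.
  move=> n; have gr B : measurable (g n @^-1` B).
    by apply: finite_range_preimage => //; exact: fimfunP.
  split.
    have := finite_image (fun t : R => t%:C *: x) (fimfunP (g n)).
    by rewrite image_comp.
  by move=> y; exact: (gr [set t | t%:C *: x = y]).
move=> m; apply/cvg_rnormP.
under eq_fun do rewrite -scalerBl -rmorphB rnorm_realZ.
rewrite -(mul0r (rnorm x)); apply: cvgMr_tmp.
have := gf m I; move/fine_cvgP => [_] /= gfm.
rewrite -(@normr0 _ R); apply: cvg_norm.
by rewrite -(subrr (f m)); apply: cvgB => //; exact: cvg_cst.
Qed.

Lemma strongly_measurable_rnorm (F : M -> X) :
  strongly_measurable F -> measurable_fun setT (fun m => rnorm (F m)).
Proof.
move=> [s [vs sF]].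
apply: (@measurable_fun_cvg _ _ _ _ (fun n m => rnorm (s n m))).
  move=> n _ B _; rewrite setTI.
  have [fs ms] := vs n.
  exact: (finite_range_preimage fs ms [set x | B (rnorm x)]).
move=> m _; have /cvg_rnormP := sF m => h.
apply/cvgrPdist_le => e e0.
move/(@cvgr0Pnorm_le R R) : h => /(_ _ e0); apply: filterS => n; rewrite ger0_norm ?rnorm_ge0// => H.
by rewrite distrC (le_trans _ H)// ler_rnormB_dist.
Qed.
End strong_measurability.

(** * Rademacher sums as averages over signs *)

Lemma le_Lnorm d (T : measurableType d) (R : realType)
    (mu : {measure set T -> \bar R}) (p : R) (f g : T -> R) :
  0 < p -> measurable_fun setT f -> measurable_fun setT g ->
  (forall w, 0 <= f w <= g w) ->
  (Lnorm mu p%:E (EFin \o f) <= Lnorm mu p%:E (EFin \o g))%E.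
Proof.
move=> p0 mf mg fg.
have pn0 : p != 0 by rewrite gt_eqF.
have pow (h : T -> R) : Lnorm mu p%:E (EFin \o h) =
    ((\int[mu]_w (`|(h w)%:E| `^ p)) `^ p^-1)%E.
  by rewrite -poweR_Lnorm// -poweRrM mulfV// poweRe1// Lnorm_ge0.
have I0 (h : T -> R) : (0 <= \int[mu]_w (`|(h w)%:E| `^ p))%E.
  by apply: integral_ge0 => w _; exact: poweR_ge0.
have Iin (h : T -> R) : ((\int[mu]_w (`|(h w)%:E| `^ p)) \in `[0, +oo])%E.
  by rewrite in_itv/= I0 leey.
rewrite !pow; apply: (gt0_ler_poweR _ (Iin f) (Iin g)).
  by rewrite invr_ge0 ltW.
apply: ge0_le_integral => [//|w _|||w _].
- by rewrite lee_fin powR_ge0.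
- exact: measurable_poweR_norm.
- exact: measurable_poweR_norm.
have /andP[f0 fgw] := fg w.
rewrite /= lee_fin ge0_ler_powR// ?nnegrE ?(ltW p0)//.
by rewrite !ger0_norm// (le_trans f0).
Qed.

Section rademacher_average.
Context dM (M : measurableType dM) (R : realType) (P : probability M R).
Variables (eps : nat -> {RV P >-> R}) (heps : rademacher_seq eps).

Let cylinder (s : nat -> R) k : set M :=
  [set m | forall i, (i < k)%N -> eps i m = s i].

Let cylinderE s k :
  cylinder s k = \bigcap_(i in [set` iota 0 k]) (eps i @^-1` [set s i]).
Proof.
have H i : (i \in iota 0 k) = (i < k)%N by rewrite mem_iota add0n.
apply/seteqP; split => m Am i ik; apply: Am; first by rewrite -H.
by change (is_true (i \in iota 0 k)); rewrite H.
Qed.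

Let measurable_eps i x : measurable (eps i @^-1` [set x]).
Proof. by rewrite -[X in measurable X]setTI; exact: measurable_funP. Qed.

Let measurable_cylinder s k : measurable (cylinder s k).
Proof.
by rewrite cylinderE; apply: fin_bigcap_measurable => // i _; exact: measurable_eps.
Qed.

Let probability_cylinder s k : (forall i, s i = 1 \/ s i = -1) ->
  P (cylinder s k) = (2^-1 ^+ k)%:E.
Proof.
move=> hs; have [indep half] := heps.
rewrite cylinderE (indep _ (fun i => [set s i])) ?iota_uniq//.
rewrite (eq_bigr (fun=> (2^-1)%:E)); last first.
  by move=> i _; have [h1 h2] := half i; case: (hs i) => ->.
by rewrite prodEFin big_const_seq count_predT size_iota iter_mulr_1.
Qed.

Let cylinderS s k x :
  cylinder s k `&` eps k @^-1` [set x] = cylinder (fun i => if i == k then x else s i) k.+1.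
Proof.
apply/seteqP; split => m.
  move=> [Am Ex] i; rewrite ltnS leq_eqVlt.
  by case: eqP => [->|_ /= ik]; [|exact: Am].
move=> Am; split; last by have := Am k (ltnSn k); rewrite eqxx.
by move=> i ik; have := Am i (ltnW ik); rewrite ltn_eqF.
Qed.

Variable X : normedModType R[i].

(** The signs start at index k: the first k have been fixed by conditioning on a cylinder and
    absorbed into u. *)
Let rad_seq k u (l : seq X) : M -> X :=
  fun m => u + \sum_(i < size l) (eps (k + i)%N m)%:C *: l`_i.

Let rad_seq_cons k u x l m :
  rad_seq k u (x :: l) m = rad_seq k.+1 (u + (eps k m)%:C *: x) l m.
Proof.
rewrite /rad_seq /= big_ord_recl /= addn0 addrA; congr (_ + _).
by apply: eq_bigr => i _; rewrite /bump /= add1n addnS addSn.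
Qed.

Lemma strongly_measurable_sum n (F : 'I_n -> M -> X) :
  (forall i, strongly_measurable (F i)) ->
  strongly_measurable (fun m => \sum_(i < n) F i m).
Proof.
elim: n F => [|n IH] F mF.
  by under eq_fun do rewrite big_ord0; exact: strongly_measurable_cst.
under eq_fun do rewrite big_ord_recl.
by apply: strongly_measurableD => //; exact: IH.
Qed.

Lemma strongly_measurable_Rad_sum n (x : 'I_n -> X) :
  strongly_measurable (Rad_sum eps x).
Proof.
apply: strongly_measurable_sum => i.
exact: strongly_measurable_scale (measurable_funP _).
Qed.

Let measurable_rad_seq k u l D :
  measurable_fun D (fun m => (rnorm (rad_seq k u l m) ^+ 2)%:E).
Proof.
apply: measurable_funTS; apply/measurable_EFinP; apply: measurable_funX.
apply: strongly_measurable_rnorm; apply: strongly_measurableD.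
  exact: strongly_measurable_cst.
apply: strongly_measurable_sum => i.
exact: strongly_measurable_scale (measurable_funP _).
Qed.

(** Induction on the list: the value of [eps k] splits the cylinder into two halves, on each of
    which the head moves into the base point. A half prescribes one more sign, whence the extra
    factor 1/2. *)
Let integral_rad_seq l k s u : (forall i, s i = 1 \/ s i = -1) ->
  (\int[P]_(m in cylinder s k) (rnorm (rad_seq k u l m) ^+ 2)%:E)%E =
  (2^-1 ^+ k * sign_avg (fun v => rnorm v ^+ 2) u l)%:E.
Proof.
elim: l k s u => [|x l IH] k s u hs.
  rewrite (eq_integral (cst (rnorm u ^+ 2)%:E)); last first.
    by move=> m _; rewrite /rad_seq big_ord0 addr0.
  rewrite integral_cst; last exact: measurable_cylinder.
  rewrite [in RHS]mulrC EFinM; exact: (f_equal2 mule erefl (probability_cylinder k hs)).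
set g := (fun m => _%:E).
have g0 m : (0 <= g m)%E by rewrite lee_fin sqr_ge0.
pose E1 := eps k @^-1` [set 1]; pose E2 := eps k @^-1` [set -1].
have dE : [disjoint E1 & E2].
  apply/disj_setPS => m [h1 h2].
  have : (1 : R) = -1 by rewrite -[LHS]h1 -[RHS]h2.
  by move=> ?; lra.
have mE1 : measurable E1 by exact: measurable_eps.
have mE2 : measurable E2 by exact: measurable_eps.
(* A Rademacher variable equals 1 or -1 only almost surely; the remaining values form the null third
   piece of the splitting below. *)
have PE : P (~` (E1 `|` E2)) = 0%E.
  rewrite probability_setC; last exact: measurableU.
  rewrite measureU//; last by apply/disj_set2P.
  have [_ /(_ k)[h1 h2]] := heps.
  apply: (etrans (f_equal2 (fun a b => 1 - (a + b))%E h1 h2)).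
  have E : 1 - (2^-1 + 2^-1) = 0 :> R by field.
  exact: (congr1 (@EFin R) E).
have int_half (e : R) : e = 1 \/ e = -1 ->
    (\int[P]_(m in cylinder s k `&` eps k @^-1` [set e]) g m)%E =
    (2^-1 ^+ k.+1 * sign_avg (fun v => rnorm v ^+ 2) (u + e%:C *: x) l)%:E.
  move=> he; rewrite -(IH k.+1 (fun i => if i == k then e else s i)); last first.
    by move=> i; case: ifP.
  rewrite cylinderS; apply: eq_integral => m /set_mem Am.
  rewrite /g rad_seq_cons.
  by have := Am k (ltnSn k); rewrite eqxx => ->.
have -> : cylinder s k = (cylinder s k `&` E1) `|` ((cylinder s k `&` E2) `|`
                         (cylinder s k `&` ~` (E1 `|` E2))).
  by rewrite -!setIUr setUA setUv setIT.
have mC := measurable_cylinder s k.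
have mN : measurable (~` (E1 `|` E2)) by apply: measurableC; exact: measurableU.
have mg D : measurable_fun D g by exact: measurable_rad_seq.
have mA1 : measurable (cylinder s k `&` E1) by exact: measurableI.
have mA2 : measurable (cylinder s k `&` E2) by exact: measurableI.
have mA3 : measurable (cylinder s k `&` ~` (E1 `|` E2)) by exact: measurableI.
have dA : [disjoint cylinder s k `&` E1 &
    (cylinder s k `&` E2) `|` (cylinder s k `&` ~` (E1 `|` E2))].
  apply/disj_setPS => m [[_ h1] [[_ h2]|[_ h2]]].
    by move/disj_setPS : dE; apply; split; [exact: h1|exact: h2].
  by apply: h2; left.
have dA' : [disjoint cylinder s k `&` E2 & cylinder s k `&` ~` (E1 `|` E2)].
  by apply/disj_setPS => m [[_ h1] [_ h2]]; apply: h2; right.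
have A30 : P (cylinder s k `&` ~` (E1 `|` E2)) = 0%E.
  by apply: (@subset_measure0 _ _ _ P _ (~` (E1 `|` E2))) => // m [].
have split1 := ge0_integral_setU P mA1 (measurableU _ _ mA2 mA3) (mg _)
  (fun m _ => g0 m) dA.
have split2 := ge0_integral_setU P mA2 mA3 (mg _) (fun m _ => g0 m) dA'.
apply: (etrans split1).
apply: (etrans (f_equal2 (fun a b => (a + b)%E) (int_half 1 _) (etrans split2
  (f_equal2 (fun a b => (a + b)%E) (int_half (-1) _) (null_set_integral mA3 (mg _) A30))))).
- by left.
- by right.
rewrite /= adde0.
rewrite -EFinD /= rmorphN rmorph1 scaleN1r scale1r exprS.
by congr EFin; field.
Qed.

Lemma L2norm_sqrE (F : M -> X) (c : R) : 0 <= c ->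
  (\int[P]_m (rnorm (F m) ^+ 2)%:E)%E = c%:E -> L2norm P F = (Num.sqrt c)%:E.
Proof.
move=> c0 h; rewrite /L2norm unlock.
under eq_integral do rewrite /= ger0_norm ?rnorm_ge0// powR_mulrn ?rnorm_ge0//.
by rewrite h poweR_EFin powR12_sqrt.
Qed.

(** The passage from the probability space to finite averages: the case k = 0, where the cylinder
    prescribes nothing. *)
Lemma L2norm_Rad_sum n (x : 'I_n -> X) :
  L2norm P (Rad_sum eps x) =
  (Num.sqrt (sign_avg (fun v => rnorm v ^+ 2) 0 (codom x)))%:E.
Proof.
apply: L2norm_sqrE; first by apply: sign_avg_ge0 => v; exact: sqr_ge0.
have := @integral_rad_seq (codom x) 0 (fun=> 1) 0 (fun=> or_introl erefl).
rewrite expr0 mul1r => <-.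
rewrite (_ : cylinder _ 0 = setT); last by apply/seteqP; split.
apply: eq_integral => m _; congr (rnorm _ ^+ 2)%:E.
rewrite /rad_seq add0r /Rad_sum size_codom.
have -> : #|'I_n| = n by rewrite card_ord.
apply: eq_bigr => i _; rewrite add0n; congr (_ *: _).
by rewrite (nth_map i) ?nth_ord_enum// size_enum_ord.
Qed.

Lemma ler_L2normD (F G : M -> X) : strongly_measurable F -> strongly_measurable G ->
  (L2norm P (F \+ G)%R <= L2norm P F + L2norm P G)%E.
Proof.
move=> mF mG; apply: (@le_trans _ _ (Lnorm P 2%:E
   (EFin \o ((fun m => rnorm (F m)) \+ (fun m => rnorm (G m)))%R))).
  apply: le_Lnorm => // [||m]; first by apply: strongly_measurable_rnorm; exact: strongly_measurableD.
    by apply: measurable_funD; exact: strongly_measurable_rnorm.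
  by rewrite rnorm_ge0 ler_rnormD.
by apply: minkowski_EFin; rewrite ?ler1n//; exact: strongly_measurable_rnorm.
Qed.

(* By contraction the norms of the partial sums increase towards that of the sum. *)
Lemma square_partial_sum_le (S : X -> X) x n (c : R) :
  (square_norm eps S x <= c%:E)%E ->
  sign_avg (fun v => rnorm v ^+ 2) 0
    [seq (Num.sqrt k.+1%:R)%:C *: iter k S (x - S x) | k <- iota 0 n] <= c ^+ 2.
Proof.
rewrite /square_norm; case: pselect => [h|//]; case: cid => F [[mF _] FS] /= Fc.
pose y k : X := (Num.sqrt k.+1%:R)%:C *: iter k S (x - S x).
pose a m := sign_avg (fun v : X => rnorm v ^+ 2) 0 (map y (iota 0 m)).
have aE m : L2norm P (square_partial_sum eps S x m) = (Num.sqrt (a m))%:E.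
  rewrite /square_partial_sum L2norm_Rad_sum /a codomE -val_enum_ord.
  by rewrite -map_comp.
have amono m : (n <= m)%N -> a n <= a m.
  move=> nm; rewrite /a (_ : iota 0 m = iota 0 n ++ iota n (m - n)).
    by rewrite map_cat sign_avg_sqr_rnorm_cat.
  by rewrite -iotaD subnKC.
have a0 m : 0 <= a m by apply: sign_avg_ge0 => v; exact: sqr_ge0.
suff : ((Num.sqrt (a n))%:E <= c%:E)%E.
  rewrite lee_fin => h'; rewrite -[leLHS]/(a n) -[a n]sqr_sqrtr//.
  by rewrite ler_pXn2r ?nnegrE ?sqrtr_ge0// (le_trans _ h') ?sqrtr_ge0.
apply/lee_addgt0Pr => e e0.
move/fine_cvgP : FS => [Ffin /(@cvgr0Pnorm_lt R R) /(_ _ e0)] [N _ hN].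
have [N' _ hN'] := Ffin.
(* Beyond n for monotonicity, beyond N and N' so that the distance to F is less than e and
   finite. *)
pose m := maxn n (maxn N N').
have Nm : (N <= m)%N by rewrite /m !leq_max leqnn orbT.
have Nm' : (N' <= m)%N by rewrite /m !leq_max leqnn !orbT.
have {hN'} hfin := hN' m Nm'.
have {hN} hlt := hN m Nm.
have mS := @strongly_measurable_Rad_sum m
  (fun k : 'I_m => (Num.sqrt k.+1%:R)%:C *: iter k S (x - S x)).
apply: (@le_trans _ _ (Num.sqrt (a m))%:E).
  by rewrite lee_fin ler_wsqrtr// amono// leq_maxl.
rewrite -aE (_ : square_partial_sum eps S x m = F \+ (square_partial_sum eps S x m \- F)); last first.
  by apply/funext => w /=; rewrite addrC subrK.
apply: le_trans (ler_L2normD mF _) _.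
  by apply: strongly_measurableD => //; exact: strongly_measurableN.
apply: leeD => //; rewrite /= in hfin hlt.
rewrite -(fineK hfin) lee_fin; apply: ltW; apply: le_lt_trans hlt.
exact: ler_norm.
Qed.
End rademacher_average.

(** * C and C^n as real Hilbert spaces *)

Section complex_hilbert.
Context (R : realType).
Implicit Types x y : R[i].

Definition complex_ip x y : R :=
  complex.Re x * complex.Re y + complex.Im x * complex.Im y.

Lemma sqr_rnorm_complexE x :
  rnorm x ^+ 2 = complex.Re x ^+ 2 + complex.Im x ^+ 2.
Proof. by rewrite rnorm_complexE sqr_sqrtr// addr_ge0// sqr_ge0. Qed.

Lemma sqr_rnorm_complexD x y :
  rnorm (x + y) ^+ 2 = rnorm x ^+ 2 + rnorm y ^+ 2 + 2 * complex_ip x y.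
Proof.
rewrite !sqr_rnorm_complexE /complex_ip; case: x y => [a b] [c e] /=.
by ring.
Qed.

Lemma sqr_rnorm_complexB x y :
  rnorm (x - y) ^+ 2 = rnorm x ^+ 2 + rnorm y ^+ 2 - 2 * complex_ip x y.
Proof.
rewrite !sqr_rnorm_complexE /complex_ip; case: x y => [a b] [c e] /=.
by ring.
Qed.

Lemma complex_ip_CS x y :
  complex_ip x y ^+ 2 <= rnorm x ^+ 2 * rnorm y ^+ 2.
Proof.
rewrite !sqr_rnorm_complexE /complex_ip; case: x y => [a b] [c e] /=.
by have := sqr_ge0 (a * e - b * c); nra.
Qed.

(** Since only squares are compared in the hypothesis, the summands may be inner products or may
    themselves be sums already estimated by Cauchy-Schwarz. *)
Lemma sum_CS (I : Type) (s : seq I) (ip a b : I -> R) :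
  (forall i, 0 <= a i) -> (forall i, 0 <= b i) ->
  (forall i, ip i ^+ 2 <= a i * b i) ->
  (\sum_(i <- s) ip i) ^+ 2 <= (\sum_(i <- s) a i) * (\sum_(i <- s) b i).
Proof.
move=> a0 b0 h; elim: s => [|i s]; first by rewrite !big_nil expr0n mulr0.
rewrite !big_cons.
have : 0 <= \sum_(j <- s) a j by exact: sumr_ge0.
have : 0 <= \sum_(j <- s) b j by exact: sumr_ge0.
move: (\sum_(j <- s) ip j) (\sum_(j <- s) a j) (\sum_(j <- s) b j) => t A B B0 A0 IH.
have hi := h i; have ai := a0 i; have bi := b0 i.
(* The cross term: (ip_i t)^2 <= (a_i B) (A b_i), then the arithmetic-geometric mean inequality.
   Squares are compared only when the left-hand side is positive. *)
have hx : 2 * (ip i * t) <= a i * B + A * b i.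
  have [/le_trans->//|ip0] := leP (2 * (ip i * t)) 0.
    by rewrite addr_ge0// mulr_ge0.
  rewrite -(@ler_pXn2r _ 2) ?nnegrE// ?(ltW ip0)//; last first.
    by rewrite addr_ge0// mulr_ge0.
  have : (ip i * t) ^+ 2 <= (a i * b i) * (A * B).
    by rewrite exprMn ler_pM ?sqr_ge0.
  have := sqr_ge0 (a i * B - A * b i).
  rewrite !exprMn; nra.
nra.
Qed.

Definition ffun_nsq n (v : {ffun 'I_n -> R[i]}) : R := \sum_k rnorm (v k) ^+ 2.
Definition ffun_ip n (v w : {ffun 'I_n -> R[i]}) : R :=
  \sum_k complex_ip (v k) (w k).

Lemma ffun_nsqD n (v w : {ffun 'I_n -> R[i]}) :
  ffun_nsq (v + w) = ffun_nsq v + ffun_nsq w + 2 * ffun_ip v w.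
Proof.
rewrite /ffun_nsq mulr_sumr -!big_split /=; apply: eq_bigr => k _.
by rewrite ffunE sqr_rnorm_complexD.
Qed.

Lemma ffun_nsqB n (v w : {ffun 'I_n -> R[i]}) :
  ffun_nsq (v - w) = ffun_nsq v + ffun_nsq w - 2 * ffun_ip v w.
Proof.
rewrite /ffun_nsq mulr_sumr -sumrN -!big_split /=; apply: eq_bigr => k _.
by rewrite !ffunE sqr_rnorm_complexB.
Qed.

Lemma ffun_ip_CS n (v w : {ffun 'I_n -> R[i]}) :
  ffun_ip v w ^+ 2 <= ffun_nsq v * ffun_nsq w.
Proof.
by apply: sum_CS => k; rewrite ?sqr_ge0//; exact: complex_ip_CS.
Qed.
End complex_hilbert.

(** * L^p norms and integrals of sign averages *)

Section Lnorm_facts.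
Context d (Om : measurableType d) (R : realType) (mu : {measure set Om -> \bar R}).

Lemma Lnorm_pow (p : R) (g : Om -> R) : 0 < p ->
  (forall w, 0 <= g w) ->
  ((Lnorm mu p%:E (EFin \o g)) `^ p = \int[mu]_w (g w `^ p)%:E)%E.
Proof.
move=> p0 g0; rewrite poweR_Lnorm; last by rewrite gt_eqF.
by apply: eq_integral => w _ /=; rewrite ger0_norm.
Qed.

Lemma Lnorm_scale (p c : R) (g : Om -> R) : 1 <= p -> 0 <= c ->
  measurable_fun setT g -> (forall w, 0 <= g w) ->
  (Lnorm mu p%:E (EFin \o (fun w => c * g w)%R) =
   c%:E * Lnorm mu p%:E (EFin \o g))%E.
Proof.
move=> p1 c0 mg g0.
have E (h : Om -> R) : (forall w, 0 <= h w) ->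
    Lnorm mu p%:E (EFin \o h) = cLnorm mu p (fun w => (h w)%:C).
  move=> h0; rewrite /cLnorm; congr (Lnorm _ _ _); apply/funext => w /=.
  by rewrite rnorm_complexE/= expr0n/= addr0 sqrtr_sqr ger0_norm.
rewrite !E//; last by move=> w; rewrite mulr_ge0.
rewrite -[in RHS](_ : rnorm c%:C = c); last first.
  by rewrite rnorm_complexE/= expr0n/= addr0 sqrtr_sqr ger0_norm.
rewrite -cLnormZ//.
by congr (cLnorm _ _ _); apply/funext => w /=; rewrite fctE rmorphM.
Qed.

Lemma measurable_sign_avg (V : zmodType) (h : V -> Om -> R) u l :
  (forall v, measurable_fun setT (h v)) ->
  measurable_fun setT (fun w => sign_avg (h^~ w) u l).
Proof.
move=> mh; elim: l u => [|x l IH] u //=.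
by apply: measurable_funM; [exact: measurable_funD|exact: measurable_cst].
Qed.

(** Minkowski's inequality, applied once per sign. *)
Lemma Lnorm_sign_avg (p : R) (V : zmodType) (h : V -> Om -> R) (n : V -> R) u l :
  1 <= p -> (forall v, measurable_fun setT (h v)) ->
  (forall v w, 0 <= h v w) ->
  (forall v, (Lnorm mu p%:E (EFin \o h v) <= (n v)%:E)%E) ->
  (Lnorm mu p%:E (EFin \o (fun w => sign_avg (h^~ w) u l)) <=
   (sign_avg n u l)%:E)%E.
Proof.
move=> p1 mh h0 hn; elim: l u => [|x l IH] u /=; first exact: hn.
have mS v := measurable_sign_avg v l mh.
have S0 v w : 0 <= sign_avg (h^~ w) v l by exact: sign_avg_ge0.
rewrite (_ : _ \o _ = EFin \o (fun w => 2^-1 *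
    (sign_avg (h^~ w) (u + x) l + sign_avg (h^~ w) (u - x) l))); last first.
  by apply/funext => w /=; rewrite mulrC.
rewrite Lnorm_scale//; first last.
- by move=> w; rewrite addr_ge0.
- exact: measurable_funD.
rewrite [in leRHS]mulrC EFinM lee_pmul2l//.
rewrite EFinD; apply: le_trans (leeD (IH _) (IH _)).
exact: minkowski_EFin.
Qed.

(** The bound on f is asked only on D, which contains every sign sum of the list. In its application
    D consists of the functions that vanish wherever a given square function does. *)
Lemma sign_avg_le_integral (V : zmodType) (D : V -> Prop) (f : V -> R)
    (g : V -> Om -> R) u l :
  (forall v v', D v -> D v' -> D (v + v')) ->
  (forall v v', D v -> D v' -> D (v - v')) ->
  (forall v, measurable_fun setT (g v)) -> (forall v w, 0 <= g v w) ->
  (forall v, D v -> ((f v)%:E <= \int[mu]_w (g v w)%:E)%E) ->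
  D u -> (forall v, v \in l -> D v) ->
  ((sign_avg f u l)%:E <= \int[mu]_w (sign_avg (g^~ w) u l)%:E)%E.
Proof.
move=> DD DB mg g0 fg; elim: l u => [|x l IH] u Du Dl /=; first exact: fg.
have Dx : D x by apply: Dl; rewrite inE eqxx.
have {}Dl v : v \in l -> D v by move=> vl; apply: Dl; rewrite inE vl orbT.
have mS v : measurable_fun setT (fun w => (sign_avg (g^~ w) v l)%:E).
  by apply/measurable_EFinP; exact: measurable_sign_avg.
have S0 v w : (0 <= (sign_avg (g^~ w) v l)%:E)%E.
  by rewrite lee_fin; exact: sign_avg_ge0.
under eq_integral do rewrite mulrC EFinM EFinD.
rewrite ge0_integralZl_EFin//; first last.
- exact: emeasurable_funD.
- by move=> w _; rewrite adde_ge0.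
rewrite ge0_integralD// mulrC EFinM lee_pmul2l//.
by rewrite EFinD leeD// IH//; [exact: DD|exact: DB].
Qed.
End Lnorm_facts.

(** * Square functions in L^p *)

Section Lp_square_functions.
Context d (Om : measurableType d) (R : realType) (mu : {measure set Om -> \bar R}).
Variables (p : R) (p1 : 1 <= p).
Local Notation X := (Lp mu p1).
Local Notation F := (cLfun mu p1).
Implicit Types (z : F) (zs : seq F).

Let p0 : 0 < p. Proof. exact: lt_le_trans p1. Qed.

Lemma rnorm_pi z :
  (rnorm (\pi_X z))%:E = Lnorm mu p%:E (EFin \o (fun w => rnorm (val z w))).
Proof.
rewrite -[RHS](fineK (cLfun_fin_num z)); congr EFin.
by rewrite /rnorm [`|_|]Lp_norm_pi.
Qed.

Definition square_fun zs (w : Om) : R :=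
  Num.sqrt (\sum_(z <- zs) rnorm (val z w) ^+ 2).

Lemma square_fun_ge0 zs w : 0 <= square_fun zs w.
Proof. exact: sqrtr_ge0. Qed.

Lemma measurable_rnorm_cLfun z : measurable_fun setT (fun w => rnorm (val z w)).
Proof. exact: cmeasurable_rnorm (cLfun_measurable z). Qed.

Lemma measurable_square_fun zs : measurable_fun setT (square_fun zs).
Proof.
apply: (@measurableT_comp _ _ _ _ _ _ (@Num.sqrt R)).
  by apply: continuous_measurable_fun; exact: sqrt_continuous.
apply: measurable_sum => z.
by apply: measurable_funX; exact: measurable_rnorm_cLfun.
Qed.

Lemma square_fun_cons_le z zs w :
  square_fun (z :: zs) w <= rnorm (val z w) + square_fun zs w.
Proof.
have s0 : 0 <= \sum_(y <- zs) rnorm (val y w) ^+ 2.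
  by apply: sumr_ge0 => y _; exact: sqr_ge0.
have r0 := rnorm_ge0 (val z w).
have h0 : 0 <= rnorm (val z w) + square_fun zs w.
  by rewrite addr_ge0// square_fun_ge0.
rewrite -[leRHS]ger0_norm// -sqrtr_sqr ler_wsqrtr// big_cons.
rewrite -[X in _ + X](sqr_sqrtr s0) -/(square_fun zs w).
have := mulr_ge0 r0 (square_fun_ge0 zs w); nra.
Qed.

Lemma Lnorm_square_fun_lty zs : (Lnorm mu p%:E (EFin \o square_fun zs) < +oo)%E.
Proof.
elim: zs => [|z zs IH].
  rewrite (_ : _ \o _ = cst 0%E); last first.
    by apply/funext => w /=; rewrite /square_fun big_nil sqrtr0.
  by rewrite Lnorm0// gt_eqF.
apply: le_lt_trans (_ : (Lnorm mu p%:E (EFin \o ((fun w => rnorm (val z w)) \+ square_fun zs)%R) < _)%E).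
  apply: le_Lnorm => //; first exact: measurable_square_fun.
    by apply: measurable_funD; [exact: measurable_rnorm_cLfun|exact: measurable_square_fun].
  by move=> w; rewrite square_fun_ge0 square_fun_cons_le.
apply: le_lt_trans (minkowski_EFin _ _ _ p1) _.
- exact: measurable_rnorm_cLfun.
- exact: measurable_square_fun.
by rewrite lte_add_pinfty// -rnorm_pi ltry.
Qed.

Definition square_fun_norm zs : R := fine (Lnorm mu p%:E (EFin \o square_fun zs)).

Lemma square_fun_normE zs :
  (square_fun_norm zs)%:E = Lnorm mu p%:E (EFin \o square_fun zs).
Proof.
by rewrite fineK// ge0_fin_numE ?Lnorm_ge0// Lnorm_square_fun_lty.
Qed.

Lemma square_fun_norm_ge0 zs : 0 <= square_fun_norm zs.
Proof. by rewrite fine_ge0// Lnorm_ge0. Qed.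

Lemma square_fun_norm_pow zs :
  ((square_fun_norm zs `^ p)%:E = \int[mu]_w (square_fun zs w `^ p)%:E)%E.
Proof.
rewrite -Lnorm_pow//; last exact: square_fun_ge0.
by rewrite -square_fun_normE poweR_EFin.
Qed.

Let piD : {morph (fun z => \pi_X z : X) : x y / x + y}.
Proof. by move=> x y; rewrite -[RHS](raddfD \pi_X). Qed.

Let piB : {morph (fun z => \pi_X z : X) : x y / x - y}.
Proof. by move=> x y; rewrite -[RHS](raddfB \pi_X). Qed.

Let evalD w : {morph (fun z => val z w) : x y / x + y}.
Proof. by []. Qed.

Let evalB w : {morph (fun z => val z w) : x y / x - y}.
Proof. by []. Qed.

Let K : R := khintchine_const R.

Let K0 : 0 <= K. Proof. exact: ler0n. Qed.

(** Khintchine's lower inequality in C at each point w; then Minkowski moves the L^p norm inside the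
    average, and Jensen passes from first to second moments. *)
Lemma square_fun_norm_le zs : square_fun_norm zs <=
  K * Num.sqrt (sign_avg (fun u : X => rnorm u ^+ 2) 0 [seq \pi_X z | z <- zs]).
Proof.
pose h z w := K * rnorm (val z w).
rewrite -lee_fin square_fun_normE.
apply: (@le_trans _ _
   (Lnorm mu p%:E (EFin \o (fun w => sign_avg (h^~ w) 0 zs)))).
  have mh z : measurable_fun setT (h z).
    by apply: measurable_funM => //; exact: measurable_rnorm_cLfun.
  apply: le_Lnorm => //; first exact: measurable_square_fun.
    exact: measurable_sign_avg.
  move=> w; rewrite square_fun_ge0 /= sign_avgZ.
  have := @khintchine_lower R R[i] (fun c => rnorm c ^+ 2) (@complex_ip R)
    (fun c => sqr_ge0 _) _ (@sqr_rnorm_complexD R) (@sqr_rnorm_complexB R)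
    (@complex_ip_CS R) [seq val z w | z <- zs].
  rewrite rnorm0 expr0n/= => /(_ erefl).
  rewrite big_map => /le_trans; apply; rewrite ler_wpM2l//.
  rewrite -[0 in leLHS](_ : val (0 : F) w = 0)// (sign_avg_map _ _ _ (@evalD w) (@evalB w)).
  apply: le_sign_avg => z /=.
  by rewrite sqrtr_sqr ger0_norm// rnorm_ge0.
apply: (@le_trans _ _ (sign_avg (fun z => K * rnorm (\pi_X z)) 0 zs)%:E).
  apply: Lnorm_sign_avg => //.
  - by move=> z; apply: measurable_funM => //; exact: measurable_rnorm_cLfun.
  - by move=> z w; rewrite mulr_ge0// rnorm_ge0.
  move=> z; rewrite Lnorm_scale//; last by move=> w; exact: rnorm_ge0.
    by rewrite -rnorm_pi.
  exact: measurable_rnorm_cLfun.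
rewrite lee_fin sign_avgZ ler_wpM2l//.
rewrite -[0 in leRHS](_ : \pi_X 0 = 0); last exact: (raddf0 \pi_X).
rewrite (sign_avg_map _ _ _ piD piB).
by apply: sign_avg_le_sqrt => z; exact: rnorm_ge0.
Qed.

(** The Hilbert-valued form: at each point w every v is a vector of C^n, the signs act on whole
    vectors, and the square function of the array is the l^2 sum of their norms. *)
Lemma square_fun_norm_flatten_le n (vs : seq {ffun 'I_n -> F}) :
  square_fun_norm (flatten [seq codom v | v : {ffun 'I_n -> F} <- vs]) <=
  K * sign_avg (fun v : {ffun 'I_n -> F} => square_fun_norm (codom v)) 0 vs.
Proof.
pose h (v : {ffun 'I_n -> F}) w := K * square_fun (codom v) w.
have mh v : measurable_fun setT (h v).
  by apply: measurable_funM => //; exact: measurable_square_fun.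
rewrite -lee_fin square_fun_normE.
apply: (@le_trans _ _
   (Lnorm mu p%:E (EFin \o (fun w => sign_avg (h^~ w) 0 vs)))).
  apply: le_Lnorm => //; first exact: measurable_square_fun.
    exact: measurable_sign_avg.
  move=> w; rewrite square_fun_ge0 /= sign_avgZ.
  pose ev (v : {ffun 'I_n -> F}) : {ffun 'I_n -> R[i]} := [ffun k => val (v k) w].
  have evD : {morph ev : x y / x + y} by move=> x y; apply/ffunP => k; rewrite !ffunE.
  have evB : {morph ev : x y / x - y} by move=> x y; apply/ffunP => k; rewrite !ffunE.
  have ev0 : ev 0 = 0 by apply/ffunP => k; rewrite !ffunE.
  have evE (v : {ffun 'I_n -> F}) :
      \sum_(z <- codom v) rnorm (val z w) ^+ 2 = ffun_nsq (ev v).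
    rewrite codomE big_map big_enum /=; apply: eq_bigr => k _.
    by rewrite ffunE.
  have := @khintchine_lower R _ (@ffun_nsq R n) (@ffun_ip R n)
    (fun v => sumr_ge0 _ (fun k _ => sqr_ge0 _)) _ (@ffun_nsqD R n) (@ffun_nsqB R n)
    (@ffun_ip_CS R n) [seq ev v | v <- vs].
  rewrite -{1 2}ev0 (sign_avg_map _ _ _ evD evB).
  rewrite /ffun_nsq big1 => [/(_ erefl)|k _]; last first.
    by rewrite !ffunE rnorm0 expr0n.
  rewrite big_map => H.
  rewrite /square_fun big_flatten big_map /=.
  under eq_bigr do rewrite evE.
  apply: le_trans H _; rewrite ler_wpM2l//; apply: le_sign_avg => v /=.
  by rewrite /square_fun evE.
rewrite -sign_avgZ; apply: Lnorm_sign_avg => //.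
- by move=> v w; rewrite mulr_ge0// square_fun_ge0.
move=> v; rewrite Lnorm_scale//; [|exact: measurable_square_fun|].
  by rewrite -square_fun_normE.
by move=> w; exact: square_fun_ge0.
Qed.

(** The C^n-valued inequality combines the xs into a single random x; for that x the scalar
    inequality and the hypothesis bound the family of all L_k x. Each inequality costs one factor
    K. *)
Lemma square_fun_norm_family_le n (L : 'I_n -> X -> X) (C : R) (xs : seq X) :
  (forall k, {morph L k : x y / x + y}) -> (forall k, {morph L k : x y / x - y}) ->
  0 <= C ->
  (forall x, sign_avg (fun u : X => rnorm u ^+ 2) 0 [seq L k x | k <- enum 'I_n] <=
     (C * rnorm x) ^+ 2) ->
  square_fun_norm (flatten [seq [seq repr (L k x) | k <- enum 'I_n] | x <- xs]) <=
  K * (K * C * Num.sqrt (sign_avg (fun u : X => rnorm u ^+ 2) 0 xs)).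
Proof.
move=> LD LB C0 hL.
pose v (x : X) : {ffun 'I_n -> F} := [ffun k => repr (L k x)].
have -> : [seq [seq repr (L k x) | k <- enum 'I_n] | x <- xs] =
    [seq codom v | v : {ffun 'I_n -> F} <- [seq v x | x <- xs]].
  rewrite -map_comp; apply: eq_map => x /=; rewrite codomE.
  by apply: eq_map => k; rewrite ffunE.
apply: le_trans (square_fun_norm_flatten_le _) _; rewrite ler_wpM2l//.
(* Under the same signs, the sum of the arrays represents (L_k x)_k at the sum x of the vectors, as
   classes only. *)
pose rel (v : {ffun 'I_n -> F}) (x : X) := forall k, \pi_X (v k) = L k x.
have E1 : [seq v x | x <- xs] = map fst [seq (v x, x) | x <- xs].
  by rewrite -map_comp.
have E2 : xs = map snd [seq (v x, x) | x <- xs].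
  by rewrite -map_comp map_id.
rewrite [in leLHS]E1.
apply: (@le_trans _ _ (sign_avg (fun x : X => K * C * rnorm x) 0 xs)); last first.
  rewrite sign_avgZ ler_wpM2l ?mulr_ge0//.
  by apply: sign_avg_le_sqrt => z; exact: rnorm_ge0.
rewrite [in leRHS]E2; apply: (@sign_avg_le_rel R _ _ rel).
- move=> a x b y ax hb k; rewrite ffunE LD -(ax k) -(hb k).
  by rewrite -[RHS](raddfD \pi_X).
- move=> a x b y ax hb k; rewrite !ffunE LB -(ax k) -(hb k).
  by rewrite -[RHS](raddfB \pi_X).
- move=> a x ax; apply: le_trans (square_fun_norm_le _) _.
  rewrite -mulrA ler_wpM2l// -[leRHS]ger0_norm ?mulr_ge0 ?rnorm_ge0//.
  rewrite -sqrtr_sqr ler_wsqrtr//; apply: le_trans (hL x).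
  rewrite codomE -map_comp (eq_map (g := fun k => L k x))//.
- by move=> k; rewrite ffunE -(subrr (0 : X)) LB !subrr; exact: (raddf0 \pi_X).
by move=> _ /mapP[x _ ->] k /=; rewrite ffunE reprK.
Qed.
End Lp_square_functions.

(** * Upper Khintchine inequality in L^p *)

Lemma powR_inj_le (R : realType) (p a b : R) : 0 < p -> 0 <= a -> 0 <= b ->
  a `^ p <= b `^ p -> a <= b.
Proof.
move=> p0 a0 b0 h.
have E (c : R) : 0 <= c -> c = (c `^ p) `^ p^-1.
  by move=> c0; rewrite -powRrM mulfV ?gt_eqF// powRr1.
rewrite (E a a0) [leRHS](E b b0); apply: (@ge0_ler_powR _ p^-1).
- by rewrite invr_ge0 ltW.
- exact: powR_ge0.
- exact: powR_ge0.
- exact: h.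
Qed.

Lemma powR_threshold (R : realType) (p q a g l : R) :
  0 < p -> p <= q -> 0 <= a -> 0 <= g -> 1 <= l -> (g = 0 -> a = 0) ->
  a `^ p <= l `^ p * g `^ p + l `^ (p - q) * (a `^ q * g `^ (p - q)).
Proof.
move=> p0 pq a0 g0 l1 ga.
have l0 : 0 < l by exact: lt_le_trans l1.
have t1 : 0 <= l `^ p * g `^ p by rewrite mulr_ge0// powR_ge0.
have t2 : 0 <= l `^ (p - q) * (a `^ q * g `^ (p - q)).
  by rewrite mulr_ge0 ?powR_ge0// mulr_ge0// powR_ge0.
move: g0; rewrite le_eqVlt => /predU1P[g0|g0].
  by rewrite {1}(ga (esym g0)) powR0 ?(gt_eqF p0)// addr_ge0.
have [alg|lga] := leP a (l * g).
  apply: (@le_trans _ _ (l `^ p * g `^ p)); last by rewrite lerDl.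
  rewrite -(powRM _ (ltW l0) (ltW g0)); apply: ge0_ler_powR => //.
    exact: ltW.
  by rewrite nnegrE ltW// mulr_gt0.
have lg0 : 0 < l * g by rewrite mulr_gt0.
have {}a0 : 0 < a by exact: lt_trans lga.
apply: (@le_trans _ _ (l `^ (p - q) * (a `^ q * g `^ (p - q)))); last first.
  by rewrite lerDr.
have -> : a `^ p = a `^ q * a `^ (p - q).
  rewrite -powRD; last by rewrite (gt_eqF a0) implybT.
  by rewrite addrC subrK.
rewrite mulrCA ler_wpM2l ?powR_ge0// -(powRM _ (ltW l0) (ltW g0)).
rewrite -(opprB q p) !powRN lef_pV2 ?posrE ?powR_gt0//.
by apply: ge0_ler_powR; rewrite ?nnegrE ?subr_ge0// ltW.
Qed.

Section Lp_khintchine_upper.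
Context d (Om : measurableType d) (R : realType) (mu : {measure set Om -> \bar R}).
Variables (p : R) (p1 : 1 <= p).
Local Notation X := (Lp mu p1).
Local Notation F := (cLfun mu p1).

Let p0 : 0 < p. Proof. exact: lt_le_trans p1. Qed.

Lemma rnorm_pi_pow (z : F) :
  ((rnorm (\pi_X z) `^ p)%:E = \int[mu]_w (rnorm (val z w) `^ p)%:E)%E.
Proof.
rewrite -Lnorm_pow//; last by move=> w; exact: rnorm_ge0.
by rewrite -rnorm_pi poweR_EFin.
Qed.

Lemma square_fun_norm0_ae (zs : seq F) : square_fun_norm zs = 0 ->
  {ae mu, forall w, square_fun zs w = 0}.
Proof.
move=> N0; have := square_fun_normE zs; rewrite N0 => /esym N0'.
have mf : measurable_fun setT (EFin \o square_fun zs).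
  by apply/measurable_EFinP; exact: measurable_square_fun.
have p0' : (0 < p%:E :> \bar R)%E by rewrite lte_fin.
by apply: filterS (Lnorm_eq0_eq0 mf p0' N0') => w /= /(_ I) [].
Qed.

(* Since 0 `^ (p - q) = 0 also when p < q, the weight below controls only those v
   that vanish where the square function does. *)
Let D (zs : seq F) (v : F) := forall w, square_fun zs w = 0 -> val v w = 0.

Let D_mem (zs : seq F) v : v \in zs -> D zs v.
Proof.
move=> vzs w /eqP; rewrite sqrtr_eq0 => h.
have h0 : \sum_(z <- zs) rnorm (val z w) ^+ 2 = 0.
  by apply/eqP; rewrite eq_le h/= sumr_ge0// => z _; exact: sqr_ge0.
have : rnorm (val v w) ^+ 2 = 0.
  apply/eqP; rewrite eq_le sqr_ge0 andbT -h0 (big_rem v)//= lerDl.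
  by rewrite sumr_ge0// => z _; exact: sqr_ge0.
by move/eqP; rewrite sqrf_eq0 rnorm_eq0 => /eqP.
Qed.

Let measurable_powR_comp (f : Om -> R) (q : R) :
  measurable_fun setT f -> measurable_fun setT (fun w => f w `^ q).
Proof.
by move=> mf; apply: (@measurableT_comp _ _ _ _ _ _ (fun x : R => x `^ q)).
Qed.

Variable m : nat.
Hypothesis m_gt0 : (0 < m)%N.
Hypothesis pm : p <= (2 * m)%:R.
Let q : R := (2 * m)%:R.

(** The second summand has total degree p but contains v only through an even power, so its sign
    average is at most a constant times G^p, pointwise. *)
Let weight (zs : seq F) (v : F) w :=
  square_fun zs w `^ p + rnorm (val v w) `^ q * square_fun zs w `^ (p - q).

Let measurable_weight zs v : measurable_fun setT (weight zs v).
Proof.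
apply: measurable_funD.
  by apply: measurable_powR_comp; exact: measurable_square_fun.
apply: measurable_funM; apply: measurable_powR_comp.
  exact: measurable_rnorm_cLfun.
exact: measurable_square_fun.
Qed.

Let weight_ge0 zs v w : 0 <= weight zs v w.
Proof. by rewrite addr_ge0 ?mulr_ge0 ?powR_ge0. Qed.

(* With b the integral of |v|^q G^(p-q) and I that of G^p, integrate
   |v|^p <= l^p G^p + l^(p-q) |v|^q G^(p-q) for the l such that l^q = 1 + b / I.
   This replaces Minkowski's inequality for the exponent q / p and treats p < 2
   and p >= 2 alike. *)
Let sqr_rnorm_le_weight zs v : 0 < square_fun_norm zs -> D zs v ->
  ((rnorm (\pi_X v) ^+ 2)%:E <=
   \int[mu]_w ((2 `^ p^-1) ^+ 2 * square_fun_norm zs ^+ 2 /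
      square_fun_norm zs `^ p * weight zs v w)%:E)%E.
Proof.
move=> nu0 Dv; set nu := square_fun_norm zs in nu0 *; set I := nu `^ p.
set n := rnorm (\pi_X v).
have n0 : 0 <= n by exact: rnorm_ge0.
have I0 : 0 < I by exact: powR_gt0.
set c := _ / I.
have c0 : 0 < c by rewrite divr_gt0// mulr_gt0// exprn_gt0// powR_gt0.
have mG : measurable_fun setT (square_fun zs) by exact: measurable_square_fun.
have mv : measurable_fun setT (fun w => rnorm (val v w)) by exact: measurable_rnorm_cLfun.
have m1 : measurable_fun setT (fun w => (square_fun zs w `^ p)%:E).
  by apply/measurable_EFinP; exact: measurable_powR_comp.
pose b_ w := rnorm (val v w) `^ q * square_fun zs w `^ (p - q).
have b0 w : (0 <= (b_ w)%:E)%E by rewrite lee_fin mulr_ge0// powR_ge0.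
have m2 : measurable_fun setT (fun w => (b_ w)%:E).
  by apply/measurable_EFinP; apply: measurable_funM; exact: measurable_powR_comp.
have g0 w : (0 <= (square_fun zs w `^ p)%:E)%E by rewrite lee_fin powR_ge0.
rewrite (eq_integral (fun w => c%:E * ((square_fun zs w `^ p)%:E + (b_ w)%:E))%E);
  last by move=> w _; rewrite EFinM EFinD.
rewrite ge0_integralZl_EFin ?(ltW c0)//; first last.
- exact: emeasurable_funD.
- by move=> w _; rewrite adde_ge0.
rewrite ge0_integralD// -square_fun_norm_pow -/nu -/I.
have B0 : (0 <= \int[mu]_w (b_ w)%:E)%E by apply: integral_ge0.
case EB : (\int[mu]_w (b_ w)%:E)%E B0 => [b| |]//; last first.
  by move=> _; rewrite addey// gt0_muley ?lte_fin// leey.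
rewrite lee_fin => b_ge0.
rewrite -EFinD -EFinM lee_fin.
pose l := (1 + b / I) `^ q^-1.
have q0 : 0 < q by rewrite ltr0n muln_gt0.
have bI : 0 <= b / I by rewrite divr_ge0// ltW.
have lq : l `^ q = 1 + b / I.
  by rewrite -powRrM mulVf ?gt_eqF// powRr1// addr_ge0.
have l1 : 1 <= l.
  by apply: (@powR_inj_le _ q); rewrite ?powR_ge0// powR1 lq lerDl.
have l0 : 0 < l by exact: lt_le_trans l1.
have np : n `^ p <= l `^ p * I + l `^ (p - q) * b.
  rewrite -lee_fin rnorm_pi_pow EFinD !EFinM square_fun_norm_pow -EB.
  rewrite -!ge0_integralZl_EFin ?powR_ge0// -ge0_integralD//; first last.
  - by apply: measurable_funeM.
  - by move=> w _; rewrite mule_ge0// lee_fin powR_ge0.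
  - by apply: measurable_funeM.
  - by move=> w _; rewrite mule_ge0// lee_fin powR_ge0.
  apply: ge0_le_integral => //.
  - by move=> w _; rewrite lee_fin powR_ge0.
  - by apply/measurable_EFinP; exact: measurable_powR_comp.
  - by apply: emeasurable_funD; apply: measurable_funeM.
  move=> w _; rewrite -!EFinM -EFinD lee_fin.
  apply: powR_threshold; rewrite ?rnorm_ge0 ?square_fun_ge0//.
  by move=> /Dv ->; rewrite rnorm0.
(* As b <= l^q I, the second term is at most l^p I, like the first. *)
have np2 : n `^ p <= 2 * (l `^ p * I).
  apply: le_trans np _; rewrite mulr_natl mulr2n lerD2l.
  apply: (@le_trans _ _ (l `^ (p - q) * (l `^ q * I))).
    rewrite ler_wpM2l ?powR_ge0// lq mulrDl mul1r divfK ?gt_eqF//.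
    by rewrite lerDr ltW.
  by rewrite mulrA -powRD ?subrK// (gt_eqF l0) implybT.
have nle : n <= 2 `^ p^-1 * (l * nu).
  apply: (powR_inj_le p0) => //; first by rewrite !mulr_ge0 ?powR_ge0// ltW.
  rewrite powRM ?powR_ge0//; last by rewrite mulr_ge0// ltW.
  by rewrite (powRM _ (ltW l0) (ltW nu0)) -powRrM mulVf ?gt_eqF// powRr1.
apply: (@le_trans _ _ ((2 `^ p^-1 * (l * nu)) ^+ 2)).
  by rewrite ler_pXn2r ?nnegrE// (le_trans n0).
(* Since l >= 1 and q >= 2, l^2 <= l^q = 1 + b / I. This is affine in b, so the bound is an integral
   of [weight] and can be averaged over signs. *)
apply: (@le_trans _ _ ((2 `^ p^-1) ^+ 2 * nu ^+ 2 * l `^ q)); last first.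
  rewrite lq /c le_eqVlt; apply/orP; left; apply/eqP; field.
  by rewrite gt_eqF.
have nu2 : 0 <= (2 `^ p^-1) ^+ 2 * nu ^+ 2 by rewrite mulr_ge0 ?sqr_ge0.
rewrite !exprMn [X in _ * X]mulrC mulrA ler_wpM2l//.
by rewrite /q (powR_mulrn _ (ltW l0)) ler_weXn2l// leq_pmulr.
Qed.

(** Average the bound by [weight] over signs under the integral. The scalar moment inequality of
    order q = 2 m bounds the mean of |v|^q by a constant times G^q, and G^q G^(p - q) = G^p
    integrates to nu^p. *)
Lemma khintchine_upper_even (zs : seq F) :
  sign_avg (fun u : X => rnorm u ^+ 2) 0 [seq \pi_X z | z <- zs] <=
  (2 `^ p^-1) ^+ 2 * (1 + (4 * m + 1)%:R ^+ m) * square_fun_norm zs ^+ 2.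
Proof.
have piD : {morph (fun z => \pi_X z : X) : x y / x + y}.
  by move=> x y; rewrite -[RHS](raddfD \pi_X).
have piB : {morph (fun z => \pi_X z : X) : x y / x - y}.
  by move=> x y; rewrite -[RHS](raddfB \pi_X).
rewrite -[0 in leLHS](_ : \pi_X 0 = 0); last exact: (raddf0 \pi_X).
rewrite (sign_avg_map _ _ _ piD piB).
set nu := square_fun_norm zs.
have D0 : D zs 0 by [].
have DD v v' : D zs v -> D zs v' -> D zs (v + v').
  by move=> hv hv' w h; rewrite /= fctE hv// hv'// addr0.
have DB v v' : D zs v -> D zs v' -> D zs (v - v').
  by move=> hv hv' w h; rewrite /= !fctE hv// hv'// subr0.
have nu_ge0 : 0 <= nu by exact: square_fun_norm_ge0.
(* If nu = 0, dividing by nu^p is impossible; but then G, and with it every function in D, vanishes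
   almost everywhere. *)
move: (nu_ge0); rewrite le_eqVlt => /predU1P[nu0|nu0].
  rewrite -nu0 expr0n/= mulr0 -lee_fin.
  apply: le_trans (@sign_avg_le_integral _ Om R mu _ (D zs) _ (fun _ _ => 0) _ _ DD DB _ _ _ D0 (@D_mem zs)) _ => //.
    move=> v Dv /=; rewrite integral0 lee_fin.
    suff -> : \pi_X v = 0 by rewrite rnorm0 expr0n.
    rewrite -(raddf0 \pi_X); apply/eqLpP.
    by apply: filterS (square_fun_norm0_ae (esym nu0)) => w /Dv.
  by rewrite integral0_eq// => w _; rewrite sign_avg_cst.
pose c := (2 `^ p^-1) ^+ 2 * nu ^+ 2 / nu `^ p.
have I0 : 0 < nu `^ p by exact: powR_gt0.
have c0 : 0 <= c by rewrite divr_ge0 ?powR_ge0// mulr_ge0 ?sqr_ge0.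
have mw v : measurable_fun setT (fun w => c * weight zs v w).
  by apply: measurable_funM => //; exact: measurable_weight.
have w0 v w : 0 <= c * weight zs v w by rewrite mulr_ge0.
rewrite -lee_fin.
apply: le_trans (@sign_avg_le_integral _ Om R mu _ (D zs) _
  (fun v w => c * weight zs v w) _ _ DD DB mw w0 _ D0 (@D_mem zs)) _ => //.
  by move=> v Dv; exact: sqr_rnorm_le_weight.
set K : R := (4 * m + 1)%:R ^+ m.
have K0 : 0 <= K by rewrite exprn_ge0.
apply: (@le_trans _ _ (\int[mu]_w ((c * (1 + K))%:E * (square_fun zs w `^ p)%:E))%E).
  have mG : measurable_fun setT (fun w => square_fun zs w `^ p).
    by apply: measurable_powR_comp; exact: measurable_square_fun.
  apply: ge0_le_integral => //.
  - by move=> w _; rewrite lee_fin sign_avg_ge0.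
  - by apply/measurable_EFinP; exact: measurable_sign_avg.
  - by apply: measurable_funeM; apply/measurable_EFinP.
  move=> w _; rewrite -EFinM lee_fin sign_avgZ -[leRHS]mulrA ler_wpM2l//.
  rewrite sign_avgD mulrDl mul1r.
  set G := square_fun zs w.
  rewrite sign_avg_cst lerD2l.
  have -> : (fun v : F => rnorm (val v w) `^ q * G `^ (p - q)) =
      (fun v : F => G `^ (p - q) * (rnorm (val v w) ^+ 2) ^+ m).
    by apply/funext => v; rewrite mulrC powR_mulrn ?rnorm_ge0// exprM.
  rewrite sign_avgZ.
  have := @khintchine_upper R R[i] (fun c => rnorm c ^+ 2) (@complex_ip R)
    (fun c => sqr_ge0 _) _ (@sqr_rnorm_complexD R) (@sqr_rnorm_complexB R)
    (@complex_ip_CS R) m [seq val z w | z <- zs].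
  rewrite rnorm0 expr0n/= => /(_ erefl).
  rewrite -[0 in X in X -> _](_ : val (0 : F) w = 0)//.
  rewrite (sign_avg_map _ _ _ (_ : {morph (fun z : F => val z w) : x y / x + y})
     (_ : {morph (fun z : F => val z w) : x y / x - y}))//.
  rewrite big_map => H.
  apply: (@le_trans _ _ (G `^ (p - q) * (K * (G ^+ 2) ^+ m))).
    rewrite ler_wpM2l ?powR_ge0//; apply: le_trans H _.
    by rewrite /G /square_fun sqr_sqrtr// sumr_ge0// => z _; exact: sqr_ge0.
  rewrite mulrCA ler_wpM2l// -exprM -powR_mulrn ?square_fun_ge0// -/q.
  have [G0|Gn0] := eqVneq G 0.
    rewrite G0 (@powR0 _ q) ?mulr0 ?powR_ge0//.
    by rewrite pnatr_eq0 muln_eq0 negb_or/= -lt0n.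
  by rewrite -powRD ?subrK// Gn0 implybT.
rewrite ge0_integralZl_EFin//; first last.
- by rewrite mulr_ge0// addr_ge0.
- apply/measurable_EFinP; apply: measurable_powR_comp; exact: measurable_square_fun.
- by move=> w _; rewrite lee_fin powR_ge0.
rewrite -square_fun_norm_pow -EFinM lee_fin -/nu /c le_eqVlt; apply/orP; left.
by apply/eqP; field; rewrite gt_eqF.
Qed.
End Lp_khintchine_upper.

Lemma Lp_khintchine_upper d (Om : measurableType d) (R : realType)
    (mu : {measure set Om -> \bar R}) (p : R) (p1 : 1 <= p) :
  exists2 K : R, 0 <= K & forall zs : seq (cLfun mu p1),
    sign_avg (fun u : Lp mu p1 => rnorm u ^+ 2) 0 [seq \pi_(Lp mu p1) z | z <- zs] <=
    K * square_fun_norm zs ^+ 2.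
Proof.
have p0 : 0 <= p by rewrite (le_trans ler01).
pose m := Num.bound p.
have pm : p < m%:R by exact: archi_boundP.
have m0 : (0 < m)%N by rewrite -(ltr_nat R) (le_lt_trans p0).
exists ((2 `^ p^-1) ^+ 2 * (1 + (4 * m + 1)%:R ^+ m)).
  by rewrite mulr_ge0 ?sqr_ge0// addr_ge0// exprn_ge0.
move=> zs; apply: khintchine_upper_even => //.
by rewrite ltW// (lt_le_trans pm)// ler_nat leq_pmull.
Qed.

(** * Duality *)

Section pairing.
Context d (Om : measurableType d) (R : realType) (mu : {measure set Om -> \bar R}).
Variables (p q : R) (p1 : 1 <= p) (q1 : 1 <= q).
Hypothesis pq : p^-1 + q^-1 = 1.
Local Notation X := (Lp mu p1).
Local Notation Y := (Lp mu q1).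
Implicit Types (f : cLfun mu p1) (g : cLfun mu q1) (x : X) (y : Y).

Let p0 : 0 < p. Proof. exact: lt_le_trans p1. Qed.
Let q0 : 0 < q. Proof. exact: lt_le_trans q1. Qed.

Lemma ge0_hoelder (f g : Om -> R) : measurable_fun setT f ->
  measurable_fun setT g -> (forall w, 0 <= f w) -> (forall w, 0 <= g w) ->
  (\int[mu]_w (f w * g w)%:E <=
   Lnorm mu p%:E (EFin \o f) * Lnorm mu q%:E (EFin \o g))%E.
Proof.
move=> mf mg f0 g0; apply: le_trans (hoelder mu mf mg p0 q0 pq).
rewrite Lnorm1 le_eqVlt; apply/orP; left; apply/eqP.
by apply: eq_integral => w _ /=; rewrite ger0_norm// mulr_ge0.
Qed.

Definition re_mul f g w := complex.Re (val f w * val g w).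

Lemma measurable_re_mul f g : measurable_fun setT (re_mul f g).
Proof.
have [fR fI] := cLfun_measurable f; have [gR gI] := cLfun_measurable g.
rewrite (_ : re_mul f g =
  (fun w => complex.Re (val f w) * complex.Re (val g w)) \-
  (fun w => complex.Im (val f w) * complex.Im (val g w))).
  by apply: measurable_funB; exact: measurable_funM.
by apply/funext => w; rewrite /re_mul /=; case: (val f w) (val g w) => [? ?] [].
Qed.

Lemma norm_re_le (c : R[i]) : `|complex.Re c| <= rnorm c.
Proof.
rewrite -(@ler_pXn2r _ 2) ?nnegrE ?rnorm_ge0// sqr_rnorm_complexE.
by rewrite -normrX ger0_norm ?sqr_ge0// lerDl sqr_ge0.
Qed.

Lemma integrable_re_mul f g : mu.-integrable setT (EFin \o re_mul f g).
Proof.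
have mf := cmeasurable_rnorm (cLfun_measurable f).
have mg := cmeasurable_rnorm (cLfun_measurable g).
apply/integrableP; split; first by apply/measurable_EFinP; exact: measurable_re_mul.
apply: (@le_lt_trans _ _ (\int[mu]_w (rnorm (val f w) * rnorm (val g w))%:E)%E).
  apply: ge0_le_integral => //.
  - by apply: measurableT_comp => //; apply/measurable_EFinP; exact: measurable_re_mul.
  - by apply/measurable_EFinP; exact: measurable_funM.
  by move=> w _ /=; rewrite lee_fin -rnormM norm_re_le.
apply: le_lt_trans (ge0_hoelder mf mg _ _) _.
- by move=> w; exact: rnorm_ge0.
- by move=> w; exact: rnorm_ge0.
by rewrite -!rnorm_pi -EFinM ltry.
Qed.

(** The real part is enough: against the dual family constructed below, the sum of the pairings is
    real and nonnegative. *)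
Definition re_pairing x y : R := complex.Re (Lp_pairing x y).

Lemma re_pairing_pi f g :
  re_pairing (\pi_X f) (\pi_Y g) = \int[mu]_w re_mul f g w.
Proof.
rewrite /re_pairing /= /Rintegral; congr fine.
apply: ae_eq_integral => //.
- by apply/measurable_EFinP; exact: measurable_re_mul.
- by apply/measurable_EFinP; exact: measurable_re_mul.
have /eqLpP hf : \pi_X (repr (\pi_X f)) = \pi_X f by rewrite reprK.
have /eqLpP hg : \pi_Y (repr (\pi_Y g)) = \pi_Y g by rewrite reprK.
by apply: filterS2 hf hg => w /= h1 h2 _; rewrite /re_mul h1 h2.
Qed.

Lemma re_pairingDl x x' y :
  re_pairing (x + x') y = re_pairing x y + re_pairing x' y.
Proof.
elim/quotW: x => f; elim/quotW: x' => f'; elim/quotW: y => g.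
rewrite -(raddfD \pi_X) !re_pairing_pi -RintegralD//; try exact: integrable_re_mul.
congr Rintegral; apply/funext => w; rewrite /re_mul /= fctE mulrDl.
by case: (_ * _) (_ * _) => [? ?] [].
Qed.

Lemma re_pairingDr x y y' :
  re_pairing x (y + y') = re_pairing x y + re_pairing x y'.
Proof.
elim/quotW: x => f; elim/quotW: y' => g'; elim/quotW: y => g.
rewrite -(raddfD \pi_Y) !re_pairing_pi -RintegralD//; try exact: integrable_re_mul.
congr Rintegral; apply/funext => w; rewrite /re_mul /= fctE mulrDr.
by case: (_ * _) (_ * _) => [? ?] [].
Qed.

Lemma re_pairing0l y : re_pairing 0 y = 0.
Proof. by apply: (addrI (re_pairing 0 y)); rewrite -re_pairingDl !addr0. Qed.

Lemma re_pairingBl x x' y :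
  re_pairing (x - x') y = re_pairing x y - re_pairing x' y.
Proof. by apply/eqP; rewrite eq_sym subr_eq -re_pairingDl subrK. Qed.

Lemma re_pairingBr x y y' :
  re_pairing x (y - y') = re_pairing x y - re_pairing x y'.
Proof. by apply/eqP; rewrite eq_sym subr_eq -re_pairingDr subrK. Qed.

Lemma re_pairingMnl x y n : re_pairing (x *+ n) y = re_pairing x y *+ n.
Proof.
by elim: n => [|n IH]; rewrite ?re_pairing0l// !mulrS re_pairingDl IH.
Qed.

Lemma re_pairing_suml (I : Type) (s : seq I) (u : I -> X) y :
  re_pairing (\sum_(i <- s) u i) y = \sum_(i <- s) re_pairing (u i) y.
Proof.
by elim: s => [|i s IH]; rewrite ?big_nil ?re_pairing0l// !big_cons re_pairingDl IH.
Qed.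

Lemma re_pairing_le f g : ((re_pairing (\pi_X f) (\pi_Y g))%:E <=
  \int[mu]_w (rnorm (val f w) * rnorm (val g w))%:E)%E.
Proof.
have mf := cmeasurable_rnorm (cLfun_measurable f).
have mg := cmeasurable_rnorm (cLfun_measurable g).
have int_fg := integrable_re_mul f g.
rewrite re_pairing_pi /Rintegral fineK; last exact: integral_fune_fin_num.
apply: le_trans (lee_abs _) _.
have m1 : measurable_fun setT (EFin \o re_mul f g).
  by apply/measurable_EFinP; exact: measurable_re_mul.
apply: le_trans (le_abse_integral _ _ m1) _ => //.
apply: ge0_le_integral => //.
- by apply: measurableT_comp.
- by apply/measurable_EFinP; exact: measurable_funM.
by move=> w _ /=; rewrite lee_fin -rnormM norm_re_le.
Qed.
End pairing.

(** * Weighted sums over halved indices *)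

Section weighted_sums.
Context (R : realType).
Implicit Types (a b : nat -> R).

Let nneg_widen a m n : (forall i, 0 <= a i) -> (m <= n)%N ->
  \sum_(0 <= i < m) a i <= \sum_(0 <= i < n) a i.
Proof.
move=> a0 mn; rewrite (big_cat_nat (leq0n m) mn)/= lerDl.
by apply: sumr_ge0 => i _.
Qed.

(** The index i comes from k = 2 i and k = 2 i + 1, of total weight 4 i + 3 <= 4 (i + 1); the shift
    by j only increases the weights on the right. *)
Lemma sum_half_le a j m N : (forall i, 0 <= a i) -> (j + m <= N)%N ->
  \sum_(0 <= k < m) k.+1%:R * a (j + k./2)%N <=
  4 * \sum_(0 <= i < N) i.+1%:R * a i.
Proof.
move=> a0 jmN.
have H M : \sum_(0 <= k < M.*2) k.+1%:R * a (j + k./2)%N <=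
    4 * \sum_(0 <= i < M) i.+1%:R * a (j + i)%N.
  elim: M => [|M IH]; first by rewrite !big_geq// mulr0.
  rewrite doubleS !big_nat_recr//= uphalf_double half_double mulrDr -addrA.
  apply: lerD => //; rewrite -mulrDl mulrA ler_wpM2r//.
  rewrite -natrD -natrM ler_nat; lia.
have ge0 (f : nat -> nat) (k : nat) : 0 <= k.+1%:R * a (f k) by rewrite mulr_ge0.
have mM : (m <= (uphalf m).*2)%N by lia.
apply: le_trans (nneg_widen (ge0 (fun k => j + k./2)%N) mM) _.
apply: le_trans (H _) _; rewrite ler_wpM2l//.
apply: (@le_trans _ _ (\sum_(0 <= i < j + uphalf m) i.+1%:R * a i)); last first.
  apply: nneg_widen => [i|]; first by rewrite mulr_ge0.
  by lia.
rewrite (big_cat_nat (leq0n j) (leq_addr (uphalf m) j))/=.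
apply: (@le_trans _ _ (\sum_(j <= i < j + uphalf m) i.+1%:R * a i)); last first.
  by rewrite lerDr sumr_ge0// => i _; rewrite mulr_ge0.
rewrite -{2}[j]add0n big_addn addKn; apply: ler_sum_nat => i _.
by rewrite addnC ler_wpM2r// ler_nat; lia.
Qed.

(** An index i >= 1 comes from k = 2 i - 1 and k = 2 i, of total weight 4 i + 1; the index 0 comes
    from k = 0 alone. *)
Lemma sum_uphalf_le b m N : (forall i, 0 <= b i) -> (m <= N)%N ->
  \sum_(0 <= k < m) k.+1%:R * b (uphalf k) <=
  4 * \sum_(0 <= i < N) i.+1%:R * b i.
Proof.
move=> b0; case: m => [|m] mN.
  by rewrite big_geq// mulr_ge0// sumr_ge0// => i _; rewrite mulr_ge0.
have H M : \sum_(0 <= k < M.*2.+1) k.+1%:R * b (uphalf k) <=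
    4 * \sum_(0 <= i < M.+1) i.+1%:R * b i.
  elim: M => [|M IH]; first by rewrite !big_nat1 /= mul1r; have := b0 0; lra.
  rewrite doubleS big_nat_recr//= big_nat_recr//= [in leRHS]big_nat_recr//= uphalf_double half_double.
  rewrite mulrDr -addrA; apply: lerD => //; rewrite -mulrDl mulrA ler_wpM2r//.
  rewrite -natrD -natrM ler_nat; lia.
have ge0 (f : nat -> nat) (k : nat) : 0 <= k.+1%:R * b (f k) by rewrite mulr_ge0.
have mM : (m.+1 <= (uphalf m).*2.+1)%N by lia.
apply: le_trans (nneg_widen (ge0 uphalf) mM) _.
apply: le_trans (H _) _; rewrite ler_wpM2l//.
apply: nneg_widen => [i|]; first by rewrite mulr_ge0.
by lia.
Qed.
End weighted_sums.

(** * Weighted sums of second differences of powers *)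

Section iter_linear.
Context (K : pzRingType) (X : lmodType K) (T : {linear X -> X}).

Lemma iter_linearD n x y : iter n T (x + y) = iter n T x + iter n T y.
Proof. by elim: n => [|n IH] //=; rewrite IH linearD. Qed.

Lemma iter_linearB n x y : iter n T (x - y) = iter n T x - iter n T y.
Proof. by elim: n => [|n IH] //=; rewrite IH linearB. Qed.

Lemma iter_linearZ n c x : iter n T (c *: x) = c *: iter n T x.
Proof. by elim: n => [|n IH] //=; rewrite IH linearZ. Qed.

Definition second_difference_sum j m x : X :=
  \sum_(0 <= k < m) iter (j + k) T (x - T x - T (x - T x)) *+ k.+1.

Lemma second_difference_sumE j m x :
  second_difference_sum j m x =
  iter j T x - iter (j + m) T x - (iter (j + m) T x - iter (j + m).+1 T x) *+ m.
Proof.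
rewrite /second_difference_sum; elim: m => [|m IH].
  by rewrite big_geq// addn0 mulr0n subrr subr0.
rewrite big_nat_recr//= IH linearB !iter_linearB -!iterSr !addnS.
(* The new summand is (m + 1) (u - v): it turns - b - m u into - c - (m + 1) v, because b - u =
   c. *)
set a := iter j T x; set b := iter (j + m) T x.
set c := iter (j + m).+1 T x; set e := iter (j + m).+2 T x.
set u := b - c; set v := c - e.
rewrite (mulrnBl m.+1 u v) [u *+ m.+1]mulrS addrA (addrC u) addrA subrK.
by rewrite /u addrA subrK.
Qed.
End iter_linear.

(** * Square functions of T along a family of vectors *)

Section square_family.
Context d (Om : measurableType d) (R : realType) (mu : {measure set Om -> \bar R}).
Variables (p : R) (p1 : 1 <= p).
Local Notation X := (Lp mu p1).
Variable T : {linear X -> X}.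
Implicit Types (x : X) (xs : seq X).

(** The summand of [square_partial_sum], shared by the hypotheses and the pointwise estimates. *)
Definition square_term k x : X := (Num.sqrt k.+1%:R)%:C *: iter k T (x - T x).

Definition square_family N xs : seq (cLfun mu p1) :=
  flatten [seq [seq repr (square_term (k : 'I_N) x) | k <- enum 'I_N] | x <- xs].

(* This representative of T^k (x - T x) is tied pointwise, and not only almost
   everywhere, to the one used in square_family. *)
Definition diff_repr k x : cLfun mu p1 :=
  (Num.sqrt k.+1%:R)^-1%:C *: repr (square_term k x).

Lemma pi_diff_repr k x : \pi_X (diff_repr k x) = iter k T (x - T x).
Proof.
rewrite /diff_repr -Lp_scale_pi reprK -[LHS]/(_ *: square_term k x) scalerA.
by rewrite -rmorphM mulVf ?rmorph1 ?scale1r// gt_eqF// sqrtr_gt0.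
Qed.

Lemma sqr_diff_repr k x w :
  k.+1%:R * rnorm (val (diff_repr k x) w) ^+ 2 =
  rnorm (val (repr (square_term k x)) w) ^+ 2.
Proof.
have -> : val (diff_repr k x) w =
  (Num.sqrt k.+1%:R)^-1%:C * val (repr (square_term k x)) w by [].
rewrite rnormM exprMn mulrA.
have -> : rnorm (Num.sqrt k.+1%:R)^-1%:C = (Num.sqrt k.+1%:R : R)^-1.
  by rewrite rnorm_complexE/= expr0n/= addr0 sqrtr_sqr ger0_norm// invr_ge0 sqrtr_ge0.
by rewrite exprVn sqr_sqrtr// mulfV// mul1r.
Qed.

Lemma square_familyE N xs w : square_fun (square_family N xs) w =
  Num.sqrt (\sum_(x <- xs) \sum_(0 <= k < N)
    k.+1%:R * rnorm (val (diff_repr k x) w) ^+ 2).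
Proof.
rewrite /square_fun big_flatten big_map; congr Num.sqrt; apply: eq_bigr => x _.
rewrite big_map big_enum /= big_mkord; apply: eq_bigr => k _.
by rewrite sqr_diff_repr.
Qed.

Lemma square_family_norm_le (C : R) N xs : 0 <= C ->
  (forall x, sign_avg (fun u : X => rnorm u ^+ 2) 0
     [seq square_term k x | k <- iota 0 N] <= (C * rnorm x) ^+ 2) ->
  square_fun_norm (square_family N xs) <=
  khintchine_const R ^+ 2 * C *
    Num.sqrt (sign_avg (fun u : X => rnorm u ^+ 2) 0 xs).
Proof.
move=> C0 hC; rewrite expr2 -!mulrA [X in _ <= _ * X]mulrA.
apply: (@square_fun_norm_family_le _ _ _ _ _ _ _ (fun k : 'I_N => square_term k)) => //.
- move=> k x y; rewrite /square_term linearD opprD addrACA iter_linearD.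
  by rewrite scalerDr.
- move=> k x y; rewrite /square_term -scalerBr -iter_linearB; congr (_ *: iter _ _ _).
  by rewrite linearB !opprB addrACA [RHS]addrACA (addrC (- y)).
- by move=> x; rewrite (map_comp (square_term^~ x)) val_enum_ord.
Qed.
End square_family.

Lemma sqr_scale_sqrt (R : realType) (c a b : R) : 0 <= a -> 0 <= b ->
  (c * (Num.sqrt a * Num.sqrt b)) ^+ 2 = (c * a) * (c * b).
Proof. by move=> a0 b0; rewrite !exprMn !sqr_sqrtr//; ring. Qed.

(** * Bilinear estimate for second differences *)

Section duality_estimate.
Context d (Om : measurableType d) (R : realType) (mu : {measure set Om -> \bar R}).
Variables (p q : R) (p1 : 1 <= p) (q1 : 1 <= q).
Hypothesis pq : p^-1 + q^-1 = 1.
Local Notation X := (Lp mu p1).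
Local Notation Y := (Lp mu q1).
Variables (T : {linear X -> X}) (S : {linear Y -> Y}).
Hypothesis adjTS : Lp_adjoint T S.

Lemma re_pairing_iter n (x : X) (y : Y) :
  re_pairing (iter n T x) y = re_pairing x (iter n S y).
Proof.
elim: n x y => [|n IH] x y //=.
by rewrite /re_pairing adjTS -/(re_pairing _ _) IH -iterSr.
Qed.

Lemma re_pairing_diff (x : X) (y : Y) :
  re_pairing (x - T x) y = re_pairing x (y - S y).
Proof.
rewrite (re_pairingBl pq) (re_pairingBr pq); congr (_ - _).
exact: (re_pairing_iter 1).
Qed.

Lemma re_pairing_second_difference_sum j m (x : X) (y : Y) :
  re_pairing (second_difference_sum T j m x) y =
  \sum_(0 <= k < m) k.+1%:R *
    re_pairing (iter (j + k./2) T (x - T x)) (iter (uphalf k) S (y - S y)).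
Proof.
rewrite (re_pairing_suml pq); apply: eq_bigr => k _.
rewrite (re_pairingMnl pq) mulr_natl; congr (_ *+ _).
(* The power [uphalf k] and one factor I - T move to the adjoint; j stays with T. *)
have -> : (j + k = uphalf k + (j + k./2))%N by lia.
rewrite iterD (re_pairing_iter (uphalf k)).
set u := x - T x.
have -> : iter (j + k./2) T (u - T u) =
    iter (j + k./2) T u - T (iter (j + k./2) T u).
  by rewrite iter_linearB -iterSr iterS.
by rewrite re_pairing_diff (iter_linearB S) -iterSr iterS.
Qed.

(** Pointwise Cauchy-Schwarz over all pairs (t, k), then Hoelder. The common bound N lets a single
    square family serve every pair (j, m). *)
Lemma second_difference_sum_pairing_le (s : seq ((nat * nat) * (X * Y))) N :
  (forall t, t \in s -> t.1.1 + t.1.2 <= N)%N ->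
  \sum_(t <- s) re_pairing (second_difference_sum T t.1.1 t.1.2 t.2.1) t.2.2 <=
  4 * (square_fun_norm (square_family T N [seq t.2.1 | t <- s]) *
       square_fun_norm (square_family S N [seq t.2.2 | t <- s])).
Proof.
move=> sN.
set xs := [seq t.2.1 | t <- s]; set ys := [seq t.2.2 | t <- s].
pose a (t : (nat * nat) * (X * Y)) w i := rnorm (val (diff_repr T i t.2.1) w).
pose b (t : (nat * nat) * (X * Y)) w i := rnorm (val (diff_repr S i t.2.2) w).
pose F t w := \sum_(0 <= k < t.1.2) k.+1%:R *
  (a t w (t.1.1 + k./2)%N * b t w (uphalf k)).
have ma t i : measurable_fun setT (fun w => a t w i).
  exact: measurable_rnorm_cLfun.
have mb t i : measurable_fun setT (fun w => b t w i).
  exact: measurable_rnorm_cLfun.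
have mk t k : measurable_fun setT (fun w => k.+1%:R *
    (a t w (t.1.1 + k./2)%N * b t w (uphalf k))).
  exact: (measurable_funM (measurable_cst _) (measurable_funM (ma t _) (mb t _))).
have mkE t k : measurable_fun setT (fun w => (k.+1%:R *
    (a t w (t.1.1 + k./2)%N * b t w (uphalf k)))%:E).
  exact/measurable_EFinP/mk.
have a0 t w i : 0 <= a t w i by exact: rnorm_ge0.
have b0 t w i : 0 <= b t w i by exact: rnorm_ge0.
have mF t : measurable_fun setT (F t) by apply: measurable_sum => k; exact: mk.
have mFE t : measurable_fun setT (fun w => (F t w)%:E) by exact/measurable_EFinP/mF.
have ab0 t w k : 0 <= k.+1%:R * (a t w (t.1.1 + k./2)%N * b t w (uphalf k)).
  exact: (mulr_ge0 (ler0n _ _) (mulr_ge0 (a0 t w _) (b0 t w _))).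
have F0 t w : 0 <= F t w by apply: sumr_ge0 => k _; exact: ab0.
rewrite -lee_fin.
apply: (@le_trans _ _ (\int[mu]_w (\sum_(t <- s) F t w)%:E)%E).
  under eq_integral do rewrite -sumEFin.
  rewrite ge0_integral_sum//; last by move=> t w _; rewrite lee_fin.
  rewrite -sumEFin; apply: lee_sum => t _.
  rewrite re_pairing_second_difference_sum.
  under eq_integral do rewrite -sumEFin.
  rewrite ge0_integral_sum//; last by move=> k w _; rewrite lee_fin; exact: ab0.
  rewrite -sumEFin; apply: lee_sum => k _.
  under eq_integral do rewrite EFinM.
  rewrite ge0_integralZl_EFin//; first last.
  - by apply/measurable_EFinP; exact: (measurable_funM (ma t _) (mb t _)).
  - by move=> w _; rewrite lee_fin; exact: (mulr_ge0 (a0 t w _) (b0 t w _)).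
  rewrite EFinM lee_pmul2l ?lte_fin ?ltr0n//.
  rewrite -(pi_diff_repr T _ t.2.1) -(pi_diff_repr S _ t.2.2).
  exact: re_pairing_le.
have mG1 := measurable_square_fun (square_family T N xs).
have mG2 := measurable_square_fun (square_family S N ys).
rewrite EFinM EFinM !square_fun_normE.
have H := ge0_hoelder mu p1 q1 pq mG1 mG2 (square_fun_ge0 _) (square_fun_ge0 _).
apply: (@le_trans _ _ (4%:E * \int[mu]_w (square_fun (square_family T N xs) w *
    square_fun (square_family S N ys) w)%:E)%E); last first.
  by apply: lee_wpmul2l => //; rewrite lee_fin.
rewrite -ge0_integralZl_EFin//; first last.
- by apply/measurable_EFinP; exact: (measurable_funM mG1 mG2).
- by move=> w _; rewrite lee_fin; exact: (mulr_ge0 (square_fun_ge0 _ _) (square_fun_ge0 _ _)).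
apply: ge0_le_integral => //.
- by move=> w _; rewrite lee_fin sumr_ge0.
- by apply/measurable_EFinP; apply: measurable_sum => t; exact: mF.
- by apply: measurable_funeM; apply/measurable_EFinP; exact: (measurable_funM mG1 mG2).
move=> w _; rewrite -EFinM lee_fin !square_familyE !big_map.
pose A2 := \sum_(t <- s) \sum_(0 <= k < N) k.+1%:R * a t w k ^+ 2.
pose B2 := \sum_(t <- s) \sum_(0 <= k < N) k.+1%:R * b t w k ^+ 2.
have wsq0 k (c : R) : 0 <= k.+1%:R * c ^+ 2.
  exact: (mulr_ge0 (ler0n _ _) (sqr_ge0 _)).
have A20 : 0 <= A2.
  by apply: sumr_ge0 => t _; apply: sumr_ge0 => k _; exact: wsq0.
have B20 : 0 <= B2.
  by apply: sumr_ge0 => t _; apply: sumr_ge0 => k _; exact: wsq0.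
rewrite -[X in _ <= 4 * (Num.sqrt X * _)]/A2 -[X in _ <= 4 * (_ * Num.sqrt X)]/B2.
pose a2 t := \sum_(0 <= k < t.1.2) k.+1%:R * a t w (t.1.1 + k./2)%N ^+ 2.
pose b2 t := \sum_(0 <= k < t.1.2) k.+1%:R * b t w (uphalf k) ^+ 2.
have a20 t : 0 <= a2 t by apply: sumr_ge0 => k _; exact: wsq0.
have b20 t : 0 <= b2 t by apply: sumr_ge0 => k _; exact: wsq0.
(* Cauchy-Schwarz in k for fixed t; it is the hypothesis of the second application of [sum_CS], over
   t. The two factors 4 from halving the indices give the 4 after the square root. *)
have Fab t : F t w ^+ 2 <= a2 t * b2 t.
  apply: sum_CS => k; [exact: wsq0|exact: wsq0|].
  move: (a t w _) (b t w _) => x y.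
  by rewrite le_eqVlt; apply/orP; left; apply/eqP; ring.
have aA : \sum_(t <- s) a2 t <= 4 * A2.
  rewrite /A2 mulr_sumr big_seq [leRHS]big_seq; apply: ler_sum => t ts.
  by apply: (sum_half_le (a := fun i => a t w i ^+ 2)) => [i|]; [exact: sqr_ge0|exact: sN].
have bB : \sum_(t <- s) b2 t <= 4 * B2.
  rewrite /B2 mulr_sumr big_seq [leRHS]big_seq; apply: ler_sum => t ts.
  apply: (sum_uphalf_le (b := fun i => b t w i ^+ 2)) => [i|]; first exact: sqr_ge0.
  by apply: leq_trans (sN t ts); exact: leq_addl.
have FF : 0 <= \sum_(t <- s) F t w by apply: sumr_ge0 => t _; exact: F0.
have RR : 0 <= 4 * (Num.sqrt A2 * Num.sqrt B2).
  exact: (mulr_ge0 (ler0n _ _) (mulr_ge0 (sqrtr_ge0 _) (sqrtr_ge0 _))).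
rewrite -(ler_pXn2r (isT : (0 < 2)%N) FF RR).
apply: le_trans (sum_CS s a20 b20 Fab) _.
rewrite (sqr_scale_sqrt _ A20 B20).
have sa0 : 0 <= \sum_(t <- s) a2 t by apply: sumr_ge0 => t _; exact: a20.
have sb0 : 0 <= \sum_(t <- s) b2 t by apply: sumr_ge0 => t _; exact: b20.
exact: (ler_pM sa0 sb0 aA bB).
Qed.
End duality_estimate.

(** * Dual family of a square function *)

Section dual_family.
Context d (Om : measurableType d) (R : realType) (mu : {measure set Om -> \bar R}).
Variables (p q : R) (hp : 1 < p) (q1 : 1 <= q).
Hypothesis pq : p^-1 + q^-1 = 1.
Let p1 : 1 <= p := ltW hp.
Local Notation X := (Lp mu p1).
Local Notation Y := (Lp mu q1).
Implicit Types (z : cLfun mu p1) (zs : seq (cLfun mu p1)).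

Let p0 : 0 < p. Proof. exact: lt_le_trans p1. Qed.
Let q0 : 0 < q. Proof. exact: lt_le_trans q1. Qed.

Let conj_mul : (p - 1) * q = p.
Proof.
have pn0 : p != 0 by rewrite gt_eqF.
have qn0 : q != 0 by rewrite gt_eqF.
have : p * q * (p^-1 + q^-1) = p * q by rewrite pq mulr1.
have -> : p * q * (p^-1 + q^-1) = q + p by field; rewrite pn0 qn0.
by move=> h; rewrite mulrBl; lra.
Qed.

(* conj(z) G^(p-2), where G is the square function; for z in zs it vanishes at
   G = 0, whatever the value of 0 `^ (p - 2). *)
Definition dual_fun zs z w : R[i] :=
  let g := square_fun zs w `^ (p - 2) in
  (complex.Re (val z w) * g) +i* (- (complex.Im (val z w) * g)).

Lemma sqr_rnorm_dual_fun zs z w : rnorm (dual_fun zs z w) ^+ 2 =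
  rnorm (val z w) ^+ 2 * (square_fun zs w `^ (p - 2)) ^+ 2.
Proof.
by rewrite !sqr_rnorm_complexE /dual_fun/=; ring.
Qed.

Lemma rnorm_le_square_fun zs z w : z \in zs ->
  rnorm (val z w) <= square_fun zs w.
Proof.
move=> zzs; rewrite -[leLHS]ger0_norm ?rnorm_ge0// -sqrtr_sqr ler_wsqrtr//.
rewrite (big_rem z)//= lerDl; apply: sumr_ge0 => y _; exact: sqr_ge0.
Qed.

Lemma mul_powR_pred zs w :
  square_fun zs w * square_fun zs w `^ (p - 2) = square_fun zs w `^ (p - 1).
Proof.
have G0 := square_fun_ge0 zs w.
have [->|Gn0] := eqVneq (square_fun zs w) 0.
  by rewrite mul0r powR0// subr_eq0 gt_eqF.
rewrite -{1}(powRr1 G0) -powRD; last by rewrite Gn0 implybT.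
by congr (_ `^ _); ring.
Qed.

Lemma rnorm_dual_fun_le zs z w : z \in zs ->
  rnorm (dual_fun zs z w) <= square_fun zs w `^ (p - 1).
Proof.
move=> zzs.
have -> : rnorm (dual_fun zs z w) = rnorm (val z w) * square_fun zs w `^ (p - 2).
  rewrite -[LHS]ger0_norm ?rnorm_ge0// -sqrtr_sqr sqr_rnorm_dual_fun -exprMn.
  by rewrite sqrtr_sqr ger0_norm// mulr_ge0 ?rnorm_ge0 ?powR_ge0.
by rewrite -mul_powR_pred ler_wpM2r ?powR_ge0// rnorm_le_square_fun.
Qed.

Let Lnorm_pred_pow zs :
  ((Lnorm mu q%:E (EFin \o (fun w => square_fun zs w `^ (p - 1))%R)) `^ q =
   ((square_fun_norm zs `^ p)%R)%:E)%E.
Proof.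
rewrite Lnorm_pow//; last by move=> w; exact: powR_ge0.
rewrite square_fun_norm_pow; apply: eq_integral => w _.
by rewrite -powRrM conj_mul.
Qed.

Let measurable_powR_square_fun zs r :
  measurable_fun setT (fun w => square_fun zs w `^ r).
Proof.
apply: (@measurableT_comp _ _ _ _ _ _ (fun x : R => x `^ r)).
  exact: measurable_powR.
exact: measurable_square_fun.
Qed.

Lemma dual_fun_mem zs z : z \in zs -> dual_fun zs z \in cLfun_pred mu q1.
Proof.
move=> zzs; have [zR zI] := cLfun_measurable z.
have mg := measurable_powR_square_fun zs (p - 2).
have md : cmeasurable_fun (dual_fun zs z).
  split; first exact: measurable_funM zR mg.
  exact: (measurableT_comp (f := @GRing.opp R) _ (measurable_funM zI mg)).
rewrite inE /=; split=> //.
have mg' := measurable_powR_square_fun zs (p - 1).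
have H := @le_cLnorm _ _ _ mu q _ _ q1 md mg' (fun w => rnorm_dual_fun_le w zzs).
apply: (le_lt_trans H).
(* Were this norm infinite, so would be its q-th power, which is the p-th power of the finite
   [square_fun_norm zs]. *)
rewrite ltNge leye_eq; apply/negP => /eqP E.
by have := Lnorm_pred_pow zs; rewrite E poweRyr ?gt_eqF.
Qed.

Definition dual zs z : cLfun mu q1 := insubd 0 (dual_fun zs z).

Lemma val_dual zs z : z \in zs -> val (dual zs z) = dual_fun zs z.
Proof. by move=> zzs; rewrite val_insubd dual_fun_mem. Qed.

(** The dual family has square function G^(p - 1), and (p - 1) q = p. *)
Lemma square_fun_norm_dual zs :
  square_fun_norm [seq dual zs z | z <- zs] `^ q = square_fun_norm zs `^ p.
Proof.
apply: EFin_inj; apply: (etrans _ (Lnorm_pred_pow zs)); rewrite square_fun_norm_pow.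
rewrite -(Lnorm_pow mu q0 (square_fun_ge0 _)).
congr ((Lnorm _ _ _) `^ _)%E; apply/funext => w /=; congr EFin.
rewrite -mul_powR_pred -[RHS]ger0_norm ?mulr_ge0 ?square_fun_ge0 ?powR_ge0//.
rewrite -sqrtr_sqr exprMn [in RHS]sqr_sqrtr; last first.
  by apply: sumr_ge0 => z _; exact: sqr_ge0.
rewrite mulr_suml {1}/square_fun big_map; congr Num.sqrt.
rewrite big_seq [RHS]big_seq; apply: eq_bigr => z zzs.
by rewrite val_dual// sqr_rnorm_dual_fun.
Qed.

(** Pointwise, z conj(z) G^(p - 2) sums to G^2 G^(p - 2) = G^p. *)
Lemma re_pairing_dual zs :
  \sum_(z <- zs) re_pairing (\pi_X z) (\pi_Y (dual zs z)) = square_fun_norm zs `^ p.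
Proof.
apply: EFin_inj; rewrite -sumEFin square_fun_norm_pow.
pose h z w := rnorm (val z w) ^+ 2 * square_fun zs w `^ (p - 2).
have h0 z w : 0 <= h z w by rewrite mulr_ge0 ?sqr_ge0 ?powR_ge0.
have mh z : measurable_fun setT (h z).
  apply: measurable_funM; last exact: measurable_powR_square_fun.
  by apply: measurable_funX; exact: measurable_rnorm_cLfun.
rewrite big_seq (eq_bigr (fun z => \int[mu]_w (h z w)%:E)%E); last first.
  move=> z zzs; rewrite re_pairing_pi /Rintegral fineK; last first.
    by apply: integral_fune_fin_num => //; exact: (integrable_re_mul pq).
  apply: eq_integral => w _; congr EFin.
  by rewrite /re_mul val_dual// /h sqr_rnorm_complexE /dual_fun; case: (val z w) => a b /=; ring.
rewrite -big_seq -ge0_integral_sum//; first last.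
- by move=> z w _; rewrite lee_fin.
- by move=> z; apply/measurable_EFinP.
apply: eq_integral => w _; rewrite sumEFin; congr EFin.
rewrite -mulr_suml -[X in X * _](@sqr_sqrtr R); last first.
  by apply: sumr_ge0 => z _; exact: sqr_ge0.
rewrite -/(square_fun zs w) expr2 -mulrA mul_powR_pred.
have G0 := square_fun_ge0 zs w.
have [->|Gn0] := eqVneq (square_fun zs w) 0.
  by rewrite mul0r powR0// gt_eqF.
rewrite -{1}(powRr1 G0) -powRD; last by rewrite Gn0 implybT.
by congr (_ `^ _); ring.
Qed.

Variables (T : {linear X -> X}) (S : {linear Y -> Y}).
Hypothesis adjTS : Lp_adjoint T S.
Variable C : R.
Hypothesis C0 : 0 <= C.
Hypothesis hT : forall n x, sign_avg (fun u : X => rnorm u ^+ 2) 0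
  [seq square_term T k x | k <- iota 0 n] <= (C * rnorm x) ^+ 2.
Hypothesis hS : forall n y, sign_avg (fun u : Y => rnorm u ^+ 2) 0
  [seq square_term S k y | k <- iota 0 n] <= (C * rnorm y) ^+ 2.

(** Testing against the dual family gives nu^p <= c sqrt(rx) nu^(p - 1), where nu is finite, so
    nu^(p - 1) can be cancelled. *)
Lemma second_difference_sum_R_bounded : exists2 K : R, 0 <= K &
  forall s : seq ((nat * nat) * X),
  sign_avg (fun u : X => rnorm u ^+ 2) 0
    [seq second_difference_sum T t.1.1 t.1.2 t.2 | t <- s] <=
  K * sign_avg (fun u : X => rnorm u ^+ 2) 0 [seq t.2 | t <- s].
Proof.
have [Kp Kp0 hKp] := Lp_khintchine_upper mu p1.
have [Kq Kq0 hKq] := Lp_khintchine_upper mu q1.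
pose k0 := khintchine_const R.
have k00 : 0 <= k0 by exact: ler0n.
(* The 4 comes from the bilinear estimate, one k0^2 C from each square family, and sqrt(Kq) from the
   upper Khintchine inequality for the dual family. *)
pose c := 4 * (k0 ^+ 2 * C) ^+ 2 * Num.sqrt Kq.
have c0 : 0 <= c.
  by rewrite /c; apply: mulr_ge0; [apply: mulr_ge0 => //; exact: sqr_ge0|exact: sqrtr_ge0].
exists (Kp * c ^+ 2); first by rewrite mulr_ge0// sqr_ge0.
move=> s.
pose z (t : (nat * nat) * X) : cLfun mu p1 := repr (second_difference_sum T t.1.1 t.1.2 t.2).
pose zs := [seq z t | t <- s].
set rx := sign_avg _ 0 [seq t.2 | t <- s].
have rx0 : 0 <= rx by apply: sign_avg_ge0 => u; exact: sqr_ge0.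
rewrite (_ : [seq second_difference_sum T t.1.1 t.1.2 t.2 | t <- s] = [seq \pi_X z | z <- zs]); last first.
  by rewrite /zs -map_comp; apply: eq_map => t /=; rewrite reprK.
apply: le_trans (hKp zs) _; rewrite -mulrA ler_wpM2l//.
set nu := square_fun_norm zs.
have nu0 : 0 <= nu by exact: square_fun_norm_ge0.
suff nule : nu <= c * Num.sqrt rx.
  have cr0 : 0 <= c * Num.sqrt rx := mulr_ge0 c0 (sqrtr_ge0 rx).
  by rewrite -(sqr_sqrtr rx0) -exprMn (ler_pXn2r (isT : (0 < 2)%N) nu0 cr0).
pose s' := [seq (t.1, (t.2, \pi_Y (dual zs (z t)))) | t <- s].
pose N := \max_(t <- s) (t.1.1 + t.1.2)%N.
have sN t : t \in s' -> (t.1.1 + t.1.2 <= N)%N.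
  move=> /mapP[t' t's ->] /=.
  exact: (@leq_bigmax_seq _ _ _ (fun t : (nat * nat) * X => t.1.1 + t.1.2)%N).
have := second_difference_sum_pairing_le pq adjTS sN.
have -> : [seq t.2.1 | t <- s'] = [seq t.2 | t <- s].
  by rewrite -map_comp; exact: eq_map.
have -> : [seq t.2.2 | t <- s'] = [seq \pi_Y y | y <- [seq dual zs z | z <- zs]].
  by rewrite /zs -!map_comp; exact: eq_map.
rewrite big_map /=.
have -> : \sum_(t <- s) re_pairing (second_difference_sum T t.1.1 t.1.2 t.2) (\pi_Y (dual zs (z t))) = nu `^ p.
  rewrite -re_pairing_dual /zs big_map; apply: eq_bigr => t _.
  by rewrite reprK.
move=> H.
have bx : square_fun_norm (square_family T N [seq t.2 | t <- s]) <=
    k0 ^+ 2 * C * Num.sqrt rx.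
  by apply: square_family_norm_le => // x; exact: hT.
have by_ ys : square_fun_norm (square_family S N ys) <=
    k0 ^+ 2 * C * Num.sqrt (sign_avg (fun u : Y => rnorm u ^+ 2) 0 ys).
  by apply: square_family_norm_le => // y; exact: hS.
have {}H : nu `^ p <= 4 * ((k0 ^+ 2 * C * Num.sqrt rx) *
   (k0 ^+ 2 * C * Num.sqrt (Kq * square_fun_norm [seq dual zs z | z <- zs] ^+ 2))).
  apply: le_trans H _; rewrite ler_wpM2l//; apply: ler_pM.
  - exact: square_fun_norm_ge0.
  - exact: square_fun_norm_ge0.
  - exact: bx.
  apply: le_trans (by_ _) _; rewrite ler_wpM2l ?mulr_ge0 ?exprn_ge0//.
  by rewrite ler_wsqrtr// hKq.
move: nu0; rewrite le_eqVlt => /predU1P[<-|nu0].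
  by rewrite mulr_ge0// sqrtr_ge0.
set nd := square_fun_norm [seq dual zs z | z <- zs] in H.
have nd0 : 0 <= nd by exact: square_fun_norm_ge0.
have ndE : nd = nu `^ (p - 1).
  have E : nd `^ q = (nu `^ (p - 1)) `^ q.
    by rewrite -powRrM conj_mul; exact: square_fun_norm_dual.
  by apply/le_anti/andP; split; apply: (powR_inj_le q0); rewrite ?powR_ge0 ?E.
have np0 : 0 < nu `^ (p - 1) by exact: powR_gt0.
rewrite -(ler_pM2r np0); apply: le_trans (le_trans _ H) _.
  rewrite -{1}(powRr1 (ltW nu0)) -powRD; last by rewrite (gt_eqF nu0) implybT.
  by rewrite addrC subrK.
rewrite sqrtrM// sqrtr_sqr ger0_norm// ndE /c le_eqVlt; apply/orP; left; apply/eqP.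
by ring.
Qed.
End dual_family.

(** * R-boundedness *)

Section R_boundedness.
Context (R : realType) (X : normedModType R[i]).
Local Notation rad2 := (sign_avg (fun u : X => rnorm u ^+ 2)).

(** A single additive operator commutes with sign sums, so its norm bound applies inside the
    average. *)
Lemma rad2_map_additive (S : X -> X) (C : R) (xs : seq X) :
  {morph S : x y / x + y} -> {morph S : x y / x - y} -> 0 <= C ->
  (forall x, rnorm (S x) <= C * rnorm x) ->
  rad2 0 [seq S x | x <- xs] <= C ^+ 2 * rad2 0 xs.
Proof.
move=> SD SB C0 hS.
have S0 : S 0 = 0 by rewrite -(subrr (0 : X)) SB !subrr.
rewrite -{1}S0 (sign_avg_map _ _ _ SD SB) -sign_avgZ.
apply: le_sign_avg => x /=; rewrite -exprMn ler_pXn2r ?nnegrE ?rnorm_ge0//.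
by rewrite mulr_ge0// rnorm_ge0.
Qed.

Lemma rad2_mapD (I : Type) (f g : I -> X) u v (s : seq I) :
  rad2 (u + v) [seq f t + g t | t <- s] <=
  2 * (rad2 u [seq f t | t <- s] + rad2 v [seq g t | t <- s]).
Proof.
elim: s u v => [|t s IH] u v /=.
  have h := ler_rnormD u v.
  have h0 := rnorm_ge0 (u + v); have h1 := rnorm_ge0 u; have h2 := rnorm_ge0 v.
  apply: (@le_trans _ _ ((rnorm u + rnorm v) ^+ 2)).
    by rewrite ler_pXn2r ?nnegrE ?addr_ge0.
  by have := sqr_ge0 (rnorm u - rnorm v); nra.
have h1 := IH (u + f t) (v + g t); have h2 := IH (u - f t) (v - g t).
rewrite [u + v + _]addrACA [u + v - _](_ : _ = u - f t + (v - g t)); last first.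
  by rewrite opprD addrACA.
by lra.
Qed.

Lemma power_bounded_rnorm (T : {linear X -> X}) : power_bounded T ->
  exists2 C : R, 0 <= C & forall n x, rnorm (iter n T x) <= C * rnorm x.
Proof.
rewrite /power_bounded; set sup := ereal_sup _ => sup_lty.
have le_sup n x : rnorm x <= 1 -> ((rnorm (iter n T x))%:E <= sup)%E.
  move=> x1; apply: (@le_trans _ _ (op_norm (iter n T))).
    by apply: ereal_sup_ubound; exists x.
  by apply: ereal_sup_ubound; exists n.
have sup0 : (0 <= sup)%E.
  apply: le_trans (le_sup 0 0 _); first by rewrite lee_fin rnorm_ge0.
  by rewrite rnorm0.
have supE : sup = (fine sup)%:E by rewrite fineK// ge0_fin_numE.
exists (fine sup); first exact: fine_ge0.
move=> n x; have [->|x0] := eqVneq x 0.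
  by rewrite -[X in iter _ _ X](scale0r 0) iter_linearZ scale0r rnorm0 mulr0.
have r0 : 0 < rnorm x by rewrite lt_neqAle eq_sym rnorm_eq0 x0 rnorm_ge0.
(* The operator norm is a supremum over the unit ball, so x is normalized first. *)
have := le_sup n ((rnorm x)^-1%:C *: x).
rewrite iter_linearZ !rnorm_realZ ger0_norm ?invr_ge0 ?(ltW r0)//.
rewrite mulVf ?gt_eqF// => /(_ (lexx _)).
by rewrite supE lee_fin mulrC ler_pdivrMr.
Qed.

Variable T : {linear X -> X}.
Variables (K C : R).
Hypothesis K0 : 0 <= K.
Hypothesis C0 : 0 <= C.
Hypothesis powT : forall n x, rnorm (iter n T x) <= C * rnorm x.
Hypothesis hV : forall s : seq ((nat * nat) * X),
  rad2 0 [seq second_difference_sum T t.1.1 t.1.2 t.2 | t <- s] <=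
  K * rad2 0 [seq t.2 | t <- s].

Let scaled_diff n x : X := (iter n T x - iter n.+1 T x) *+ n.

Let scaled_diffD n : {morph scaled_diff n : x y / x + y}.
Proof. by move=> x y; rewrite /scaled_diff !iter_linearD opprD addrACA mulrnDl. Qed.

Let scaled_diffB n : {morph scaled_diff n : x y / x - y}.
Proof.
move=> x y; rewrite /scaled_diff !iter_linearB -mulrnBl; congr (_ *+ _).
by rewrite !opprB addrACA [RHS]addrACA [- iter n T y + _]addrC.
Qed.

Let B := 1 + C + Num.sqrt K.

(** From n T^n (I - T) = I - T^n - V_(0,n). The three terms of B bound these operators in order, the
    last because the estimate for families with one entry is an operator norm bound. *)
Let scaled_diff_le n x : rnorm (scaled_diff n x) <= B * rnorm x.
Proof.
have E : scaled_diff n x =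
    x - iter n T x - second_difference_sum T 0 n x.
  by rewrite second_difference_sumE add0n /= opprB addrC subrK.
have := hV [:: ((0, n), x)]; rewrite /= !add0r !rnormN.
set v := second_difference_sum T 0 n x in E *.
have -> (c : R) : (c + c) / 2 = c by field.
have -> (c : R) : (c + c) / 2 = c by field.
move=> hv.
have {}hv : rnorm v <= Num.sqrt K * rnorm x.
  rewrite -[leLHS]ger0_norm ?rnorm_ge0// -sqrtr_sqr.
  rewrite -[rnorm x]ger0_norm ?rnorm_ge0// -sqrtr_sqr -sqrtrM//.
  exact: ler_wsqrtr.
have h1 := ler_rnormD (x - iter n T x) (- v).
have h2 := ler_rnormD x (- iter n T x).
rewrite E; rewrite rnormN in h1; rewrite rnormN in h2.
have h3 := powT n x.
apply: (le_trans h1); apply: (le_trans (lerD h2 hv)).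
by rewrite /B !mulrDl mul1r lerD2r lerD2l.
Qed.

(** N is the largest exponent in the family: T^N and N T^N (I - T) become single operators, and the
    varying factor (N - n) / N in [0, 1] is removed by contraction. The nested factors 2 come from
    two uses of [rad2_mapD]. *)
Lemma rad2_iter_le (s : seq (nat * X)) :
  rad2 0 [seq iter t.1 T t.2 | t <- s] <=
  2 * (C ^+ 2 + 2 * (B ^+ 2 + K)) * rad2 0 [seq t.2 | t <- s].
Proof.
pose N := \max_(t <- s) t.1.
pose V (t : nat * X) := second_difference_sum T t.1 (N - t.1) t.2.
pose c (t : nat * X) : R := (N - t.1)%:R / N%:R.
have tN t : t \in s -> (t.1 <= N)%N.
  by move=> ts; exact: (@leq_bigmax_seq _ _ _ (fun t : nat * X => t.1)).
have -> : [seq iter t.1 T t.2 | t <- s] =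
    [seq iter N T t.2 + ((c t)%:C *: scaled_diff N t.2 + V t) | t <- s].
  apply/eq_in_map => t ts; rewrite /V second_difference_sumE subnKC ?tN//.
  have -> : (c t)%:C *: scaled_diff N t.2 =
      (iter N T t.2 - iter N.+1 T t.2) *+ (N - t.1).
    rewrite /scaled_diff -scaler_nat scalerA -scaler_nat; congr (_ *: _).
    (* If N = 0 the quotient defaults to 0, which is the right coefficient since N - n = 0. *)
    rewrite /c; have [->|N0] := eqVneq N 0.
      by rewrite sub0n mul0r rmorph0 mul0r.
    rewrite -(rmorph_nat (real_complex R)) -(rmorphM (real_complex R)).
    by rewrite divfK ?pnatr_eq0// rmorph_nat.
  by rewrite addrC [X in X + _](addrC) subrK subrK.
have rx0 : 0 <= rad2 0 [seq t.2 | t <- s].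
  by apply: sign_avg_ge0 => u; exact: sqr_ge0.
have sumE := @rad2_mapD _ (fun t : nat * X => iter N T t.2)
  (fun t => (c t)%:C *: scaled_diff N t.2 + V t) 0 0 s.
rewrite addr0 in sumE; apply: (le_trans sumE).
have sumE2 := @rad2_mapD _ (fun t : nat * X => (c t)%:C *: scaled_diff N t.2) V 0 0 s.
rewrite addr0 in sumE2.
have h1 : rad2 0 [seq iter N T t.2 | t <- s] <= C ^+ 2 * rad2 0 [seq t.2 | t <- s].
  rewrite (map_comp (iter N T) snd).
  apply: rad2_map_additive => // [x y|x y|x].
  - exact: iter_linearD.
  - exact: iter_linearB.
  - exact: powT.
have h2 : rad2 0 [seq (c t)%:C *: scaled_diff N t.2 | t <- s] <=
    B ^+ 2 * rad2 0 [seq t.2 | t <- s].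
  have := @sign_avg_contraction R X [seq (c t, scaled_diff N t.2) | t <- s] 0.
  rewrite -!map_comp => /(_ _)/le_trans; apply.
    move=> _ /mapP[t ts ->] /=; rewrite /c ger0_norm ?divr_ge0//.
    have [->|N0] := eqVneq N 0; first by rewrite invr0 mulr0.
    by rewrite ler_pdivrMr ?ltr0n ?lt0n// mul1r ler_nat leq_subr.
  rewrite (map_comp (scaled_diff N) snd).
  apply: rad2_map_additive => [x y|x y||x].
  - exact: scaled_diffD.
  - exact: scaled_diffB.
  - by rewrite /B addr_ge0 ?sqrtr_ge0// addr_ge0.
  - exact: scaled_diff_le.
have h3 : rad2 0 [seq V t | t <- s] <= K * rad2 0 [seq t.2 | t <- s].
  have := hV [seq ((t.1, (N - t.1)%N), t.2) | t <- s].
  by rewrite -!map_comp.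
rewrite -mulrA ler_wpM2l// mulrDl lerD// -mulrA.
by apply: (le_trans sumE2); rewrite ler_wpM2l// mulrDl lerD.
Qed.

(** The index [t.1] stands for n - 1 in n (T^n - T^(n-1)) = - I + V_(0,n-1) + T^n, so the bound for
    powers is used at [t.1.+1]. *)
Lemma rad2_scaled_diff_le (s : seq (nat * X)) :
  rad2 0 [seq t.1.+1%:R *: (iter t.1.+1 T t.2 - iter t.1 T t.2) | t <- s] <=
  2 * (1 + 2 * (K + 2 * (C ^+ 2 + 2 * (B ^+ 2 + K)))) * rad2 0 [seq t.2 | t <- s].
Proof.
pose V (t : nat * X) := second_difference_sum T 0 t.1 t.2.
have -> : [seq t.1.+1%:R *: (iter t.1.+1 T t.2 - iter t.1 T t.2) | t <- s] =
    [seq (- 1) *: t.2 + (V t + iter t.1.+1 T t.2) | t <- s].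
  apply: eq_map => t; rewrite /V second_difference_sumE add0n scaler_nat /=.
  set a := iter t.1 T t.2; set b := T a.
  rewrite scaleN1r -!addrA addKr addrCA -(opprB a b) mulNrn mulrSr opprD opprB.
  by rewrite (addrC (- a)).
have sumE := @rad2_mapD _ (fun t : nat * X => (- 1) *: t.2)
  (fun t => V t + iter t.1.+1 T t.2) 0 0 s.
rewrite addr0 in sumE; apply: (le_trans sumE).
have sumE2 := @rad2_mapD _ V (fun t : nat * X => iter t.1.+1 T t.2) 0 0 s.
rewrite addr0 in sumE2.
have h1 : rad2 0 [seq (- 1) *: t.2 | t <- s] <= 1 * rad2 0 [seq t.2 | t <- s].
  rewrite mul1r.
  rewrite (_ : map _ s = [seq ct.1%:C *: ct.2 | ct <- [seq (-1, t.2) | t <- s]]); last first.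
    by rewrite -map_comp; apply: eq_map => t /=; rewrite rmorphN1.
  apply: le_trans (sign_avg_contraction _ _) _.
    by move=> _ /mapP[t ts ->] /=; rewrite normrN1.
  by rewrite -map_comp.
have h2 : rad2 0 [seq V t | t <- s] <= K * rad2 0 [seq t.2 | t <- s].
  have := hV [seq ((0%N, t.1), t.2) | t <- s].
  by rewrite -!map_comp.
have h3 := rad2_iter_le [seq (t.1.+1, t.2) | t <- s].
rewrite -!map_comp in h3.
rewrite -mulrA ler_wpM2l// mulrDl lerD// -mulrA.
by apply: (le_trans sumE2); rewrite ler_wpM2l// mulrDl lerD.
Qed.
End R_boundedness.

(** Choosing an index for each operator turns a finite family in E into a list. The bound K concerns
    squared norms, hence the constant sqrt(K). *)
Lemma R_bounded_of_sign_avg dM (M : measurableType dM) (R : realType)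
    (P : probability M R) (eps : nat -> {RV P >-> R}) (heps : rademacher_seq eps)
    (X : normedModType R[i]) (E : set (X -> X)) (F : nat -> X -> X) (K : R) :
  0 <= K -> (forall S, E S -> exists n, S = F n) ->
  (forall s : seq (nat * X),
    sign_avg (fun u : X => rnorm u ^+ 2) 0 [seq F t.1 t.2 | t <- s] <=
    K * sign_avg (fun u : X => rnorm u ^+ 2) 0 [seq t.2 | t <- s]) ->
  R_bounded eps E.
Proof.
move=> K0 EF hF; exists (Num.sqrt K); first exact: sqrtr_ge0.
move=> n T x ET.
have [f Tf] := choice (fun k => EF (T k) (ET k)).
rewrite !(L2norm_Rad_sum heps) -EFinM lee_fin -sqrtrM// ler_wsqrtr//.
have -> : codom (fun k => T k (x k)) =
    [seq F t.1 t.2 | t <- [seq (f k, x k) | k <- enum 'I_n]].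
  by rewrite codomE -map_comp; apply: eq_map => k /=; rewrite Tf.
have -> : codom x = [seq t.2 | t <- [seq (f k, x k) | k <- enum 'I_n]].
  by rewrite codomE -map_comp; exact: eq_map.
exact: hF.
Qed.

Theorem theorem5p3 (R : realType)
    (dM : measure_display) (M : measurableType dM) (P : probability M R)
    (eps : nat -> {RV P >-> R}) (heps : rademacher_seq eps)
    (d : measure_display) (Om : measurableType d)
    (mu : {measure set Om -> \bar R}) (p : R) (hp : 1 < p)
    (T : {linear Lp mu (ltW hp) -> Lp mu (ltW hp)})
    (Tstar : {linear Lp mu (conj_exp_ge1 hp) -> Lp mu (conj_exp_ge1 hp)})
    (hTstar : Lp_adjoint T Tstar)
    (hT : power_bounded T)
    (hsq : exists2 C : R, 0 < C &
       (forall x : Lp mu (ltW hp),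
          (square_norm eps T x <= C%:E * (rnorm x)%:E)%E) /\
       (forall y : Lp mu (conj_exp_ge1 hp),
          (square_norm eps Tstar y <= C%:E * (rnorm y)%:E)%E)) :
  R_Ritt eps T.
Proof.
have [C C0 [hTC hSC]] := hsq.
have p0 : p != 0 by rewrite gt_eqF// (lt_trans ltr01).
have p10 : p - 1 != 0 by rewrite subr_eq0 gt_eqF.
have pq : p^-1 + (conj_exp p)^-1 = 1.
  by rewrite /conj_exp invf_div; field.
(* The hypothesis on the whole series bounds every partial sum, uniformly in n. *)
have hT2 n x : sign_avg (fun u : Lp mu (ltW hp) => rnorm u ^+ 2) 0
    [seq square_term T k x | k <- iota 0 n] <= (C * rnorm x) ^+ 2.
  by apply: (square_partial_sum_le heps); rewrite EFinM.
have hS2 n y : sign_avg (fun u : Lp mu (conj_exp_ge1 hp) => rnorm u ^+ 2) 0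
    [seq square_term Tstar k y | k <- iota 0 n] <= (C * rnorm y) ^+ 2.
  by apply: (square_partial_sum_le heps); rewrite EFinM.
have [K K0 hV] := second_difference_sum_R_bounded pq hTstar (ltW C0) hT2 hS2.
have [C' C'0 powT] := power_bounded_rnorm hT.
have B0 : 0 <= C' ^+ 2 + 2 * ((1 + C' + Num.sqrt K) ^+ 2 + K).
  by rewrite addr_ge0 ?sqr_ge0// mulr_ge0// addr_ge0// sqr_ge0.
split.
  apply: (R_bounded_of_sign_avg heps _ _ (rad2_iter_le K0 C'0 powT hV)).
    by rewrite mulr_ge0.
  by move=> _ [n _ <-]; exists n.
apply: (R_bounded_of_sign_avg heps _ _ (rad2_scaled_diff_le K0 C'0 powT hV)).
  by rewrite mulr_ge0// addr_ge0// mulr_ge0// addr_ge0// mulr_ge0.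
(* The condition 1 <= n excludes 0; the operator of index n + 1 is the one listed under n. *)
by move=> _ [[|n] // _ <-]; exists n.
Qed.
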